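(* Let $c>0$ and let $X$ be a random variable such that $\mathbb{P}(X>\epsilon)\le\exp(-c\epsilon)$ and $\mathbb{P}(X\le-\epsilon)\le\exp(-c\epsilon)$ for all $\epsilon\ge0$. Let $\rho:\mathcal{L}\to\mathbb{R}$ be a risk measure of type (T1) with parameters $L>0$ and $\kappa\in(0,1]$. Then, for every $n\ge1$ and every $\epsilon>0$ satisfying $\left(\frac{\epsilon}{L}\right)^{1/\kappa}>\frac{384}{c\sqrt n}$, $$\mathbb{P}\left(|\rho_n-\rho(X)|>\epsilon\right)\le\exp\left(-\frac{n}{\frac{32}{c^2}+\frac4c\left(\left(\frac{\epsilon}{L}\right)^{1/\kappa}-\frac{384}{c\sqrt n}\right)}\left(\left(\frac{\epsilon}{L}\right)^{1/\kappa}-\frac{384}{c\sqrt n}\right)^2\right).$$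
   Context: $\mathcal{L}$ is the set of CDFs on $\mathbb{R}$. A risk measure is a map $\rho:\mathcal{L}\to\mathbb{R}$; if $X$ has CDF $F$, $\rho(X)$ means $\rho(F)$. A risk measure $\rho$ is of type (T1) with parameters $L>0$, $\kappa\in(0,1]$ if $|\rho(F)-\rho(G)|\le L\,(W_1(F,G))^\kappa$ for all $F,G\in\mathcal{L}$. $W_1$ is the 1-Wasserstein distance: $W_1(F_1,F_2)=\inf\int_{\mathbb{R}^2}|x-y|\,dF(x,y)$ over joint distributions $F$ with marginals $F_1,F_2$; equivalently $W_1(F_1,F_2)=\int_{-\infty}^{\infty}|F_1(s)-F_2(s)|\,ds$. Given i.i.d. samples $X_1,\dots,X_n$ from the distribution of $X$, $F_n(x)=\frac1n\sum_{i=1}^n\mathbf 1\{X_i\le x\}$ is the empirical distribution function, and $\rho_n=\rho(F_n)$. *)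

(* Defs.v *)
From HB Require Import structures.
From mathcomp Require Import all_boot all_order all_algebra.
From mathcomp Require Import all_classical all_reals all_analysis.

Set Implicit Arguments.
Unset Strict Implicit.
Unset Printing Implicit Defensive.

Import Order.TTheory GRing.Theory Num.Theory.
Import numFieldNormedType.Exports.

Local Open Scope classical_set_scope.
Local Open Scope ring_scope.

(* MathComp-Analysis development over an arbitrary [R : realType].
   [cumulativeBounded 0 1]: nondecreasing right-continuous functions [R -> R]
   with limits 0 at -oo and 1 at +oo, i.e. all CDFs on the real line. *)
Notation CDF R := (cumulativeBounded (0 : R) (1 : R)).

Section law_cdf.
Context d (T : measurableType d) (R : realType) (P : probability T R).
Context (X : {RV P >-> R}).

(* The library's [cdf X] is extended-real valued; it is everywhere finite. *)
Definition law_cdf_fun (t : R) : R := fine (cdf X t).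

Let law_cdf_nd : nondecreasing law_cdf_fun.
Proof.
by move=> s t st; rewrite fine_le ?fin_num_measure// cdf_nondecreasing.
Qed.

Let law_cdf_rc : right_continuous law_cdf_fun.
Proof.
move=> a; apply: fine_cvg.
by rewrite fineK ?fin_num_measure//; exact: cdf_right_continuous.
Qed.

Let law_cdf_Ny0 : law_cdf_fun @ -oo --> (0 : R).
Proof. exact/fine_cvg/cvg_cdfNy0. Qed.

Let law_cdf_y1 : law_cdf_fun @ +oo --> (1 : R).
Proof. exact/fine_cvg/cvg_cdfy1. Qed.

Definition law_cdf : CDF R := HB.pack law_cdf_fun
  (isCumulative.Build R _ R law_cdf_fun law_cdf_nd law_cdf_rc)
  (isCumulativeBounded.Build R 0 1 law_cdf_fun law_cdf_Ny0 law_cdf_y1).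

End law_cdf.

Section empirical_cdf.
Context (R : realType) (n : nat).

Definition empirical_cdf_fun (x : 'I_n -> R) (t : R) : R :=
  n%:R^-1 * \sum_(i < n) (x i <= t)%R%:R.

Context (n_gt0 : (0 < n)%N) (x : 'I_n -> R).

Let empirical_cdf_nd : nondecreasing (empirical_cdf_fun x).
Proof.
move=> s t st; rewrite ler_wpM2l ?invr_ge0// ler_sum// => i _.
by rewrite ler_nat; case: (leP (x i) s) => // /le_trans/(_ st) ->.
Qed.

Let cvg_empirical (F : set_system R) (FF : Filter F) (b : 'I_n -> bool) :
  (forall i, \forall t \near F, (x i <= t)%R = b i) ->
  empirical_cdf_fun x @ F --> n%:R^-1 * \sum_(i < n) ((b i)%:R : R).
Proof.
move=> /filter_forall h; apply: cvg_near_cst; apply: filterS h => t ht.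
by rewrite /empirical_cdf_fun; congr (_ * _); apply: eq_bigr => i _; rewrite ht.
Qed.

Let empirical_cdf_rc : right_continuous (empirical_cdf_fun x).
Proof.
move=> a; apply: cvg_empirical => i.
have [xa|ax] := leP (x i) a.
- near=> t; apply: (le_trans xa); apply: ltW; near: t.
  exact: nbhs_right_gt.
- near=> t; apply/negbTE; rewrite -ltNge; near: t.
  exact: nbhs_right_lt.
Unshelve. all: by end_near. Qed.

Let empirical_cdf_Ny0 : empirical_cdf_fun x @ -oo --> (0 : R).
Proof.
have -> : (0 : R) = n%:R^-1 * \sum_(i < n) (false%:R : R).
  by rewrite big1 ?mulr0.
apply: cvg_empirical => i; near=> t; apply/negbTE; rewrite -ltNge; near: t.
exact/nbhs_ninfty_lt/num_real.
Unshelve. all: by end_near. Qed.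

Let empirical_cdf_y1 : empirical_cdf_fun x @ +oo --> (1 : R).
Proof.
have -> : (1 : R) = n%:R^-1 * \sum_(i < n) (true%:R : R).
  by rewrite sumr_const card_ord mulVf// pnatr_eq0 -lt0n.
apply: cvg_empirical => i; near=> t; near: t.
exact/nbhs_pinfty_ge/num_real.
Unshelve. all: by end_near. Qed.

Definition empirical_cdf : CDF R := HB.pack (empirical_cdf_fun x)
  (isCumulative.Build R _ R (empirical_cdf_fun x)
    empirical_cdf_nd empirical_cdf_rc)
  (isCumulativeBounded.Build R 0 1 (empirical_cdf_fun x)
    empirical_cdf_Ny0 empirical_cdf_y1).

End empirical_cdf.

Section wasserstein.
Context (R : realType).

(* A joint law on the plane with marginal CDFs [F] and [G]; marginals are
   determined by their values on the half-lines ]-oo, t]. *)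
Definition coupling (F G : CDF R) : set (probability (R * R)%type R) :=
  [set mu | (forall t, mu (`]-oo, t] `*` setT) = (F t)%:E) /\
            (forall t, mu (setT `*` `]-oo, t]) = (G t)%:E)].

(* Extended-real valued: the distance is [+oo] for some pairs of CDFs. *)
Definition W1 (F G : CDF R) : \bar R :=
  ereal_inf [set \int[mu]_z `|z.1 - z.2|%:E | mu in coupling F G]%E.

(* Stated in the extended reals: no constraint when [W1 F G = +oo], since
   then the right-hand side is [+oo] for [L, kappa > 0]. *)
Definition type_T1 (L kappa : R) (rho : CDF R -> R) : Prop :=
  forall F G : CDF R,
    (`|rho F - rho G|%:E <= L%:E * poweR (W1 F G) kappa)%E.

End wasserstein.

Section iid.
Context d (T : measurableType d) (R : realType) (P : probability T R).

Definition mutually_independent (I : finType) (X : I -> {RV P >-> R}) : Prop :=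
  forall (J : {set I}) (B : I -> set R), (forall i, measurable (B i)) ->
    P (\bigcap_(i in [set` J]) (X i @^-1` B i)) =
    (\prod_(i in J) P (X i @^-1` B i))%E.

Definition same_law d' (T' : measurableType d') (P' : probability T' R)
    (Y : {RV P >-> R}) (X : {RV P' >-> R}) : Prop :=
  forall B : set R, measurable B -> distribution P Y B = distribution P' X B.

End iid.

(* Main.v *)
Require Import Defs.
From HB Require Import structures.
From mathcomp Require Import all_boot all_order all_algebra.
From mathcomp Require Import all_classical all_reals all_analysis.
From mathcomp Require Import measurable_realfun ring lra.

Import Order.TTheory GRing.Theory Num.Theory.
Import numFieldNormedType.Exports.

Local Open Scope classical_set_scope.
Local Open Scope ring_scope.

(* The distance [f x = \int |F_x - F|] between the empirical CDF of a sample [x]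
   and the true CDF [F] dominates their Wasserstein distance (couple the two
   laws through their quantile functions), and (T1) turns
   [eps < |rho_n - rho(X)|] into [(eps / L) ^ (1 / kappa) < f X].
   The map [f] is [1/n]-Lipschitz in each coordinate.  Integrating out one
   coordinate at a time, each step multiplies the exponential moment of
   [lambda * f] by at most [1 + 2 u^2 / (1 - u)], where [u = 2 lambda / (c n)],
   because the fluctuation in that coordinate is at most
   [(|X_k| + E|X|) lambda / n] and [X_k] has exponential tails.  The mean of [f]
   is at most [4 / (c sqrt n)], from the variance of [F_n] at each point, well
   below [384 / (c sqrt n)]; Chernoff's bound then gives the claim. *)

(** * Measurability of functions continuous for the l1 distance *)

(** Neither [rho] nor the type ['I_n -> R] of samples comes with a measurable structure, so the
    argument is phrased for functions that are Lipschitz for the l1 distance: composed with the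
    sample they are measurable, and the class is stable, with the same constant, under averaging out
    a coordinate. The variables are unbounded, which rules out a bounded-difference argument; the
    exponential moment in one coordinate is controlled by the tail instead. Reading [b (|y| + m)] as
    the midpoint of [2 b |y|] and [2 b m] doubles the rate, whence [u = 2 b / c] with
    [b = lambda / n], and the requirement [u < 1]. With [t = c D], the exponent per sample is
    [2 u^2 / (1 - u) - u t / 2]. It is minimal where [1 / (1 - u) = sqrt (1 + t / 4)]; the
    first-order expansion [1 + t / 8] of this root gives the rational choice [u = t / (8 + t)], with
    exponent [- t^2 / (4 (8 + t))]. *)

Definition l1dist {R : realType} {n : nat} (x y : 'I_n -> R) : R :=
  \sum_(i < n) `|x i - y i|.

Lemma l1dist_ge0 {R : realType} {n : nat} (x y : 'I_n -> R) : 0 <= l1dist x y.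
Proof. by apply: sumr_ge0. Qed.

Lemma l1distC {R : realType} {n : nat} (x y : 'I_n -> R) :
  l1dist x y = l1dist y x.
Proof. by apply: eq_bigr => i _; rewrite distrC. Qed.

Lemma l1dist_triangle {R : realType} {n : nat} (y x z : 'I_n -> R) :
  l1dist x z <= l1dist x y + l1dist y z.
Proof. by rewrite -big_split; apply: ler_sum => i _; exact: ler_distD. Qed.

(** The l1 distance is separable: an open set is the countable union of the balls with rational
    centre and radius that it contains, and each ball has a measurable preimage. *)
Lemma measurable_l1open_preimage {d} {A : measurableType d} {R : realType}
    {n : nat} (u : 'I_n -> A -> R) (U : set ('I_n -> R)) :
  (forall i, measurable_fun setT (u i)) ->
  (forall x, U x -> exists2 e, 0 < e & forall y, l1dist x y < e -> U y) ->
  measurable [set w | U (u ^~ w)].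
Proof.
move=> mu oU.
pose c (p : {ffun 'I_n -> rat} * rat) (i : 'I_n) : R := ratr (p.1 i).
pose r (p : {ffun 'I_n -> rat} * rat) : R := ratr p.2.
pose F p := [set w | (forall y, l1dist (c p) y < r p -> U y) /\
                     l1dist (c p) (u ^~ w) < r p].
have -> : [set w | U (u ^~ w)] = \bigcup_p F p.
  apply/seteqP; split=> [w /= Uw|w [p _ [pU]] /pU//].
  have [e e0 eU] := oU _ Uw.
  have /rat_in_itvoo[s /itvP sP] : 0 < e / 2 by rewrite divr_gt0.
  have s0 : 0 < ratr s :> R by rewrite sP.
  have se : ratr s < e / 2 by rewrite sP.
  (* Dividing by [n + 1] rather than [n] keeps the sum of the [n] errors strictly below the radius
     and also covers [n = 0]. *)
  have qP i : exists q : rat, `|ratr q - u i w| < ratr s / n.+1%:R.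
    have /rat_in_itvoo[q /itvP qP] : u i w < u i w + ratr s / n.+1%:R.
      by rewrite ltrDl divr_gt0.
    by exists q; rewrite gtr0_norm ?subr_gt0 ?qP// ltrBlDl qP.
  have qd : l1dist (c ([ffun i => xchoose (qP i)], s)) (u ^~ w) < ratr s.
    apply: (@le_lt_trans _ _ (\sum_(i < n) (ratr s / n.+1%:R))).
      apply: ler_sum => i _; rewrite /c /= ffunE.
      exact/ltW/(xchooseP (qP i)).
    rewrite sumr_const card_ord -[_ *+ n]mulr_natr -mulrA gtr_pMr//.
    by rewrite mulrC ltr_pdivrMr// mul1r ltr_nat.
  exists ([ffun i => xchoose (qP i)], s) => //; split => // y yd.
  apply: eU; apply: (le_lt_trans (l1dist_triangle (c ([ffun i => xchoose (qP
      i)], s)) _ _)).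
  rewrite l1distC; apply: (lt_le_trans (ltrD qd yd)).
  by rewrite /r /=; lra.
apply: countable_bigcupT_measurable => [|p]; first exact: countableP.
have mF : measurable [set w | l1dist (c p) (u ^~ w) < r p].
  have : measurable_fun setT (fun w => l1dist (c p) (u ^~ w) < r p).
    apply: measurable_fun_ltr => //; apply: measurable_sum => i.
    by apply: measurableT_comp => //; apply: measurable_funB.
  by move=> /(_ measurableT [set true]); rewrite setTI; exact.
(* Whether the ball lies in [U] does not depend on [w], so [F p] is either the full preimage of the
   ball or empty. *)
have [pU|npU] := pselect (forall y, l1dist (c p) y < r p -> U y).
  rewrite (_ : F p = [set w | l1dist (c p) (u ^~ w) < r p])//.
  by apply/seteqP; split => w //= [].
by rewrite (_ : F p = set0)//; apply/seteqP; split => w //= [].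
Qed.

Lemma measurable_l1lipschitz {d} {A : measurableType d} {R : realType}
    {n : nat} (u : 'I_n -> A -> R) (g : ('I_n -> R) -> R) (b : R) :
  (forall i, measurable_fun setT (u i)) ->
  (forall x y, `|g x - g y| <= b * l1dist x y) ->
  measurable_fun setT (fun w => g (u ^~ w)).
Proof.
move=> mu glip.
apply: (measurability _ (RGenOInfty.measurableE R)) => //.
move=> _ [_ [a ->] <-]; rewrite setTI set_itvoy.
apply: (@measurable_l1open_preimage _ _ _ _ u [set x | a < g x]) => // x /= ax.
(* [b] has no assumed sign; [|b| + 1] is a positive Lipschitz constant to divide by. *)
have b1 : 0 < `|b| + 1 by rewrite ltr_wpDl.
exists ((g x - a) / (`|b| + 1)); first by rewrite divr_gt0 ?subr_gt0.
move=> y; rewrite ltr_pdivlMr// => xy.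
have := glip x y; have := ler_norm (g x - g y).
have : b * l1dist x y <= (`|b| + 1) * l1dist x y.
  by rewrite ler_wpM2r ?l1dist_ge0// (le_trans (ler_norm b))// lerDl.
lra.
Qed.

(** * Resampling one coordinate of an independent sample *)

(** Independence on rectangles identifies the law of [(Y, Z)] with a product measure, and Tonelli's
    theorem applies. [A] is arbitrary because [integral_resample] takes for it the sample space with
    a coarser sigma-algebra. *)
Lemma indep_integral {d dA} {T : measurableType d} {A : measurableType dA}
    {R : realType} (P : probability T R) (mu : probability R R)
    (Y : {mfun T >-> A}) (Z : {mfun T >-> R}) (h : A * R -> \bar R) :
  (forall B C, measurable B -> measurable C ->
    P (Y @^-1` B `&` Z @^-1` C) = (P (Y @^-1` B) * mu C)%E) ->
  measurable_fun setT h -> (forall p, 0 <= h p)%E ->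
  (\int[P]_w h (Y w, Z w) = \int[P]_w \int[mu]_z h (Y w, z))%E.
Proof.
move=> ind mh h0.
pose YZ w := (Y w, Z w).
have mYZ : measurable_fun setT YZ by exact: measurable_fun_pair.
pose YZm : {mfun T >-> (A * R)%type} := HB.pack YZ (isMeasurableFun.Build _ _ _
    _ YZ mYZ).
transitivity (\int[distribution P YZm]_p h p)%E.
  by rewrite ge0_integral_distribution.
transitivity (\int[distribution P Y \x mu]_p h p)%E.
  apply: eq_measure_integral => B mB _; apply/esym.
  by apply: product_measure_unique => // B1 C mB1 mC; rewrite -ind.
rewrite fubini_tonelli1// ge0_integral_distribution//.
  exact: measurable_fun_fubini_tonelli_F.
by move=> y; apply: integral_ge0.
Qed.

Definition upd {R : realType} {n : nat} (x : 'I_n -> R) (k : 'I_n) (z : R)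
  : 'I_n -> R := fun i => if i == k then z else x i.

Section iid_coordinate.
Context {R : realType} {d} {T : measurableType d} (P : probability T R)
  {n : nat} (X : 'I_n -> {RV P >-> R}) (mu : probability R R).
Hypothesis X_indep : mutually_independent X.
Hypothesis X_law : forall i B, measurable B -> P (X i @^-1` B) = mu B.

(* These rectangles generate the sigma-algebra of the coordinates other than
   [k]; the domain stays [T], so no type of sequences is needed. *)
Definition rect_others (k : 'I_n) : set (set T) :=
  [set A | exists B : 'I_n -> set R, [/\ forall i, measurable (B i),
     B k = setT & A = \bigcap_i (X i @^-1` B i)]].

Lemma rect_others_measurable (k : 'I_n) A : rect_others k A -> measurable A.
Proof.
move=> [B [mB _ ->]]; apply: fin_bigcap_measurable => // i _.
exact: measurable_funPTI.
Qed.

Lemma rect_others_indep (k : 'I_n) A C : rect_others k A -> measurable C ->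
  P (A `&` X k @^-1` C) = (P A * mu C)%E.
Proof.
move=> [B [mB Bk ->]] mC.
(* Slot [k] of the rectangle is free, so [C] can be put there and the intersection is again a
   rectangle. *)
pose B' i := if i == k then C else B i.
have mB' i : measurable (B' i) by rewrite /B'; case: ifP.
have -> : \bigcap_i (X i @^-1` B i) `&` X k @^-1` C = \bigcap_i (X i @^-1` B'
    i).
  apply/seteqP; split=> [w [/= wB wC] i _|w wB'].
    by rewrite /B' /=; case: eqP => [->//|_]; exact: wB.
  split=> [i _|]; last by have := wB' k I; rewrite /B' /= eqxx.
  have := wB' i I; rewrite /B' /=; case: eqP => [->|//].
  by rewrite Bk.
have := X_indep [set: 'I_n]%SET B mB; have := X_indep [set: 'I_n]%SET B' mB'.
have -> : [set` [set: 'I_n]%SET] = [set: 'I_n].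
  by apply/seteqP; split => i //=; rewrite inE.
move=> -> ->; rewrite (bigD1 k) ?inE//= [in RHS](bigD1 k) ?inE//=.
rewrite Bk preimage_setT probability_setT mul1e {1}/B' eqxx muleC X_law//.
congr (_ * _)%E; apply: eq_bigr => i /andP[_ /negbTE ik].
by rewrite /B' ik.
Qed.

(** As functions of [A], both sides are finite measures: a restriction and a scalar multiple of [P].
    They agree on the rectangles, which are stable under intersection, hence on the generated
    sigma-algebra. *)
Lemma sigma_others_indep (k : 'I_n) A C : <<s rect_others k >> A ->
  measurable C -> P (A `&` X k @^-1` C) = (P A * mu C)%E.
Proof.
move=> sA mC.
have mkC : measurable (X k @^-1` C) by exact: measurable_funPTI.
have -> : P (A `&` X k @^-1` C) = mrestr P mkC A by [].
have muC : mu C = (fine (mu C))%:E by rewrite fineK// fin_num_measure.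
have c0 : 0 <= fine (mu C) by rewrite fine_ge0.
rewrite muC muleC -[RHS]/(mscale (NngNum c0) P A).
apply: (@g_sigma_algebra_measure_unique _ _ _ (rect_others k) _
  (fun=> setT)) => //.
- by move=> B /rect_others_measurable.
- move=> _; exists (fun=> setT); split => //.
  by apply/seteqP; split.
- by apply/seteqP; split => // x _; exists 0%N.
- move=> A1 A2 [B1 [mB1 B1k ->]] [B2 [mB2 B2k ->]].
  exists (fun i => B1 i `&` B2 i); split.
  + by move=> i; exact: measurableI.
  + by rewrite B1k B2k setIT.
  + by rewrite -bigcapI.
- move=> B oB /=.
  by rewrite /mrestr rect_others_indep// {1}muC muleC.
- move=> _ /=; rewrite /mrestr setTI.
  by rewrite (le_lt_trans (probability_le1 _ _))// ltry.
Qed.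

(** The coordinates other than [k] are represented by the identity map of [T] into [T] with the
    sigma-algebra of [rect_others k]; this map is independent of [X k]. The Lipschitz bound supplies
    joint measurability. *)
Lemma integral_resample (k : 'I_n) (g : ('I_n -> R) -> R) (phi : R -> R) (b :
    R) :
  (forall x y, `|g x - g y| <= b * l1dist x y) ->
  measurable_fun setT phi -> (forall r, 0 <= phi r) ->
  (\int[P]_w (phi (g (X ^~ w)))%:E =
   \int[P]_w \int[mu]_z (phi (g (upd (X ^~ w) k z)))%:E)%E.
Proof.
move=> glip mphi phi0.
pose A := g_sigma_algebraType (rect_others k).
have sub B : <<s rect_others k >> B -> measurable B.
  apply: smallest_sub; first exact: sigma_algebra_measurable.
  exact: rect_others_measurable.
have mid : measurable_fun setT (id : T -> A) by move=> _ B mB; rewrite setTI;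
    exact: sub.
pose Y : {mfun T >-> A} := HB.pack (id : T -> A) (isMeasurableFun.Build _ _ T A
    id mid).
pose u i (p : A * R) := upd (X ^~ p.1) k p.2 i.
have mu' i : measurable_fun setT (u i).
  rewrite /u /upd; have [ik|/eqP ik] := eqVneq i k; first exact: measurable_snd.
  apply: (@measurableT_comp _ _ _ _ _ _ (X i : A -> R) _ fst) => //.
  move=> _ B mB; rewrite setTI; apply: sub_sigma_algebra.
  exists (fun j => if j == i then B else setT); split.
  - by move=> j; case: ifP.
  - by case: eqP => // ki; case: ik.
  - apply/seteqP; split=> [w /= wB j _|w /(_ i I)]; last by rewrite eqxx.
    by case: eqP => // ->.
have := @indep_integral _ _ _ _ _ P mu Y (X k) (fun p => (phi (g (u ^~ p)))%:E).
rewrite /= => <-//.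
- apply: eq_integral => w _; congr ((phi (g _))%:E); apply/funext => i.
  by rewrite /u /upd /=; case: eqP => // ->.
- by move=> B C mB mC; exact: sigma_others_indep.
- apply/measurable_EFinP; apply: measurableT_comp => //.
  exact: (measurable_l1lipschitz _ _ b).
- by move=> p; rewrite lee_fin.
Qed.

End iid_coordinate.

(** * Exponential moments under exponential tails *)

Lemma integral_expR_decay {R : realType} (k : R) : 0 < k ->
  (\int[lebesgue_measure]_(t in `[0%R, +oo[) (expR (- (k * t)))%:E
   = (k^-1)%:E)%E.
Proof.
move=> k0.
pose F t : R := - (k^-1 * expR (- (k * t))).
have dF (t : R) : is_derive t (1 : R) F (expR (- (k * t))).
  rewrite /F; apply: is_derive_eq.
  rewrite /GRing.scale /=. field; rewrite gt_eqF//.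
have cf : continuous (fun t : R => expR (- (k * t))).
  move=> s; apply/differentiable_continuous/derivable1_diffP.
  exact: ex_derive.
rewrite (@ge0_continuous_FTC2y _ _ F 0 0).
- by rewrite /F mulr0 oppr0 expR0 mulr1 -EFinB opprK add0r.
- by move=> x _; exact: expR_ge0.
- exact: continuous_subspaceT.
- rewrite -[X in _ --> X]oppr0; apply: cvgN.
  rewrite -[X in _ --> X](mulr0 k^-1); apply: cvgM; first exact: cvg_cst.
  apply: (@cvg_comp _ _ _ (fun t => k * t) (fun t => expR (- t)) _ +oo) => //.
    exact: gt0_cvgMry.
  exact: cvgr_expR.
- by move=> x _; case: (dF x).
- apply: cvg_at_right_filter.
  apply/differentiable_continuous/derivable1_diffP; exact: ex_derive.
- by move=> x _; rewrite derive1E; case: (dF x).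
Qed.

(** The integrand is the derivative of [expR (th * t) - th * t]; it is the layer-cake weight of
    [integral_expR_norm_le]. *)
Lemma integral_expRB1 {R : realType} (th r : R) : 0 <= r ->
  (\int[lebesgue_measure]_(t in `[0%R, r[) (th * (expR (th * t) - 1))%:E
   = (expR (th * r) - th * r - 1)%:E)%E.
Proof.
pose f (t : R) := th * (expR (th * t) - 1).
have cf : continuous f.
  move=> t; apply/differentiable_continuous/derivable1_diffP.
  by rewrite /f; exact: ex_derive.
rewrite le_eqVlt => /predU1P[<-|r0].
  by rewrite set_itvco0 ?integral_set0 ?mulr0 ?expR0 ?subr0 ?subrr//= lexx.
pose F t : R := expR (th * t) - th * t.
have dF (t : R) : is_derive t (1 : R) F (f t).
  rewrite /F; apply: is_derive_eq.
  by rewrite /f /GRing.scale /=; ring.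
have cF : continuous F.
  move=> t; apply/differentiable_continuous/derivable1_diffP; exact: ex_derive.
rewrite integral_itv_bndo_bndc; last first.
  apply/measurable_EFinP/measurable_funTS; exact: continuous_measurable_fun.
rewrite (@continuous_FTC2 _ f F)//.
- by rewrite /F mulr0 expR0 subr0 -EFinB.
- exact: continuous_subspaceT.
- split.
  + by move=> x _; case: (dF x).
  + exact/cvg_at_right_filter/cF.
  + exact/cvg_at_left_filter/cF.
- by move=> x _; rewrite derive1E; case: (dF x).
Qed.

Lemma double_le_expRBexpRN {R : realType} (t : R) : 0 <= t ->
  2 * t <= expR t - expR (- t).
Proof.
move=> t0.
pose F (s : R) : R := expR s - expR (- s) - 2 * s.
have dF (s : R) : is_derive s (1 : R) F (expR s + expR (- s) - 2).
  rewrite /F; apply: is_derive_eq.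
  by rewrite /GRing.scale /=; ring.
have cF : continuous F.
  move=> s; apply/differentiable_continuous/derivable1_diffP; exact: ex_derive.
suff : F 0 <= F t by rewrite /F oppr0 mulr0; lra.
apply: (@ger0_derive1_le _ F 0 t _ _ true false).
- by move=> x _; case: (dF x).
- move=> x _; rewrite derive1E; case: (dF x) => _ ->.
  have := expR_gt0 x; rewrite expRN => e0.
  have -> : expR x + (expR x)^-1 - 2 = (expR x - 1) ^+ 2 / expR x.
    by field; rewrite gt_eqF//.
  by rewrite divr_ge0 ?sqr_ge0 ?ltW.
- exact: continuous_subspaceT.
- by rewrite in_itv /= lexx.
- by rewrite in_itv /= lexx t0.
- exact: t0.
Qed.

(** Equality for [v >= 0]; for [v < 0] it amounts to [s <= sinh s] at [s = - v]. It isolates the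
    linear term, which vanishes on centred variables, from an even remainder. *)
Lemma expR_le_addB {R : realType} (v : R) : expR v <= v + (expR `|v| - `|v|).
Proof.
have [v0|v0] := leP 0 v; first by rewrite ger0_norm//; lra.
rewrite ltr0_norm//.
have /double_le_expRBexpRN : 0 <= - v by lra.
rewrite opprK; lra.
Qed.

(** From [expR t >= expR s * (1 + t - s)] and [expR s >= 1]. *)
Lemma expRB_mono {R : realType} (s t : R) : 0 <= s -> s <= t ->
  expR s - s <= expR t - t.
Proof.
move=> s0 st.
have -> : expR t = expR s * expR (t - s) by rewrite -expRD addrC subrK.
have h1 := expR_ge1Dx (t - s).
have h2 : 1 <= expR s by have := expR_ge1Dx s; lra.
have h3 : 0 <= t - s by lra.
nra.
Qed.

(** Since [expR t >= (1 + t/2)^2] and [(1 + t/2)^2 - 2t = (1 - t/2)^2]. It makes [|y|] integrable as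
    soon as [expR (th * |y|) - th * |y|] is. *)
Lemma le_expRB {R : realType} (t : R) : 0 <= t -> t <= expR t - t.
Proof.
move=> t0; have -> : expR t = expR (t / 2) ^+ 2.
  by rewrite -expRM_natl; congr expR; field.
have : (1 + t / 2) ^+ 2 <= expR (t / 2) ^+ 2.
  by rewrite lerXn2r ?nnegrE ?expR_ge0 ?expR_ge1Dx ?addr_ge0 ?divr_ge0.
by have := sqr_ge0 (1 - t / 2); lra.
Qed.

Lemma expR_mid {R : realType} (s t : R) :
  expR ((s + t) / 2) <= (expR s + expR t) / 2.
Proof.
have -> : expR s = expR (s / 2) ^+ 2.
  by rewrite -expRM_natl; congr expR; field.
have -> : expR t = expR (t / 2) ^+ 2.
  by rewrite -expRM_natl; congr expR; field.
rewrite mulrDl expRD; have := sqr_ge0 (expR (s / 2) - expR (t / 2)); lra.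
Qed.

Lemma measurable_natr_bool {d} {A : measurableType d} {R : realType}
    (b : A -> bool) : measurable_fun setT b ->
  measurable_fun setT (fun x => (b x)%:R : R).
Proof. by move=> mb; apply: (@measurableT_comp _ _ _ _ _ _ (fun b : bool =>
    b%:R : R)). Qed.

Lemma integral_natr_bool {d} {A : measurableType d} {R : realType}
    (mu : {measure set A -> \bar R}) (b : A -> bool) :
  measurable_fun setT b ->
  (\int[mu]_x ((b x)%:R : R)%:E = mu [set x | b x])%E.
Proof.
move=> mb; have mB : measurable [set x | b x].
  by have := mb measurableT [set true] I; rewrite setTI; exact.
rewrite -[in RHS](setIT [set x | b x]) -integral_indic//.
apply: eq_integral => x _; rewrite indicE; congr ((nat_of_bool _)%:R%:E).
by apply/idP/idP => [bx|/set_mem//]; rewrite mem_set.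
Qed.

(** The value is [2 th (1 / (c - th) - 1 / c)]. The subtracted exponential is first added to both
    sides, so that all integrands stay nonnegative, and its finite integral is removed at the
    end. *)
Lemma integral_expR_tail {R : realType} (c th : R) : 0 <= th -> th < c ->
  (\int[lebesgue_measure]_(t in `[0%R, +oo[)
     (th * (expR (th * t) - 1) * (2 * expR (- (c * t))))%:E
   = (2 * th ^+ 2 / (c * (c - th)))%:E)%E.
Proof.
move=> th0 thc; have c0 : 0 < c by lra.
have cth : 0 < c - th by lra.
have mexp (k : R) : measurable_fun (`[0, +oo[%classic : set R) (fun t : R =>
    expR (- (k * t))).
  apply: measurable_funTS; apply: measurableT_comp => //.
  by apply: measurable_funN; apply: measurable_funM.
set J := LHS.
have : (J + (2 * th)%:E * (c^-1)%:E = (2 * th)%:E * ((c - th)^-1)%:E)%E.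
  rewrite -(integral_expR_decay _ c0) -(integral_expR_decay _ cth).
  have Zl k : ((2 * th)%:E * \int[lebesgue_measure]_(t in `[0%R, +oo[) (expR (-
      (k * t)))%:E
      = \int[lebesgue_measure]_(t in `[0%R, +oo[) ((2 * th) * expR (- (k *
          t)))%:E)%E.
    rewrite -ge0_integralZl//=; first by apply/measurable_EFinP; exact: mexp.
    by rewrite lee_fin mulr_ge0.
  rewrite !Zl.
  rewrite /J -ge0_integralD//=; last 4 first.
  - move=> t; rewrite /= in_itv /= andbT => t0.
    rewrite lee_fin !mulr_ge0 ?expR_ge0// subr_ge0.
    by rewrite (le_trans _ (expR_ge1Dx _))// lerDl mulr_ge0.
  - apply/measurable_EFinP; apply: measurable_funM; last first.
      by apply: measurable_funM; last exact: mexp.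
    apply: measurable_funTS; apply: measurable_funM => //.
    by apply: measurable_funB => //; apply: measurableT_comp.
  - by move=> t _; rewrite lee_fin !mulr_ge0 ?expR_ge0.
  - by apply/measurable_EFinP; apply: measurable_funM; last exact: mexp.
  apply: eq_integral => t _; rewrite -EFinD; congr (_%:E).
  have -> : - ((c - th) * t) = th * t + - (c * t) by ring.
  by rewrite expRD; ring.
move=> /(congr1 (fun x => x - (2 * th * c^-1)%:E)%E).
rewrite -!EFinM addeK// -EFinB => ->; congr (_%:E).
by field; rewrite !gt_eqF.
Qed.

(** Layer cake: [expR (th |y|) - th |y|] is [1] plus the integral of [th (expR (th t) - 1)] over
    [0 <= t < |y|]; Tonelli's theorem then brings in the tail of [mu]. Removing [th |y|] makes the
    weight vanish at [t = 0], which yields an excess of order [th^2]. *)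
Lemma integral_expR_norm_le {R : realType} (mu : probability R R) (c th : R) :
  0 <= th -> th < c ->
  (forall t : R, 0 <= t -> (mu [set y | (t < `|y|)%R] <= (2 * expR (- (c *
      t)))%:E)%E) ->
  (\int[mu]_y (expR (th * `|y|) - th * `|y|)%:E
   <= (1 + 2 * th ^+ 2 / (c * (c - th)))%:E)%E.
Proof.
move=> th0 thc tail.
pose w (t : R) := th * (expR (th * t) - 1).
have w0 (t : R) : 0 <= t -> 0 <= w t.
  move=> t0; rewrite mulr_ge0// subr_ge0.
  by rewrite (le_trans _ (expR_ge1Dx _))// lerDl mulr_ge0.
have mw : measurable_fun setT w.
  apply: measurable_funM => //; apply: measurable_funB => //.
  by apply: measurableT_comp => //; apply: measurable_funM.
pose b (y t : R) := (0 <= t) && (t < `|y|).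
pose k (p : R * measurableTypeR R) : \bar R := ((b p.1 p.2)%:R * w p.2)%:E.
have k0 p : (0 <= k p)%E.
  rewrite lee_fin /b; case: (boolP (0 <= p.2)) => [t0|_]; last by rewrite mul0r.
  by rewrite mulr_ge0 ?w0.
have mk : measurable_fun setT k.
  apply/measurable_EFinP; apply: measurable_funM; last first.
    by apply: (@measurableT_comp _ _ _ _ _ _ w).
  apply: measurable_natr_bool; apply: measurable_and.
    exact: measurable_fun_ler.
  apply: measurable_fun_ltr => //.
  exact: measurableT_comp.
have psiE y : (expR (th * `|y|) - th * `|y|)%:E =
    (1 + \int[lebesgue_measure]_t k (y, t))%E.
  have -> : (\int[lebesgue_measure]_t k (y, t) =
     \int[lebesgue_measure]_(t in `[0%R, `|y|%R[) (w t)%:E)%E.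
    rewrite [RHS]integral_mkcond; apply: eq_integral => t _.
    rewrite patchE mem_setE in_itv /= /k /b /=.
    by case: ifP; rewrite ?mul1r ?mul0r.
  rewrite integral_expRB1// -EFinD; congr (_%:E); ring.
under eq_integral do rewrite psiE.
rewrite ge0_integralD//; last 2 first.
- by move=> y _; apply: integral_ge0.
- exact: (@measurable_fun_fubini_tonelli_F _ _ _ _ _ _ k).
rewrite integral_cst//= probability_setT mule1 EFinD leeD2l//.
rewrite (fubini_tonelli k)//.
rewrite -(integral_expR_tail _ _ th0 thc) [leRHS]integral_mkcond.
apply: ge0_le_integral => //.
- by move=> t _; apply: integral_ge0.
- exact: (@measurable_fun_fubini_tonelli_G _ _ _ _ _ _ k).
- apply/(measurable_restrictT _ _).1 => //.
  apply/measurable_EFinP; apply: measurable_funM; first exact: measurable_funTS.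
  apply: measurable_funTS; apply: measurable_funM => //.
  apply: measurableT_comp => //.
  by apply: measurable_funN; apply: measurable_funM.
- move=> t _; rewrite patchE mem_setE in_itv /= andbT.
  case: ifPn => t0; last first.
    by rewrite integral0_eq// => y _; rewrite /k /b /= (negbTE t0) mul0r.
  under eq_integral do rewrite /k /b /= t0 /= EFinM.
  have mb : measurable_fun setT (fun y : R => t < `|y|).
    by apply: measurable_fun_ltr => //; exact: measurableT_comp.
  rewrite ge0_integralZr//; last 2 first.
  + by apply/measurable_EFinP; exact: measurable_natr_bool.
  + by rewrite lee_fin w0.
  rewrite integral_natr_bool// muleC [leRHS]EFinM.
  by apply: lee_pmul; rewrite ?lee_fin ?w0 ?tail.
Qed.

Section exponential_tails.
Context {R : realType} (mu : probability R R) (c : R).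
Hypothesis tail : forall t : R, 0 <= t ->
  (mu [set y | (t < `|y|)%R] <= (2 * expR (- (c * t)))%:E)%E.

Lemma integrable_expR_norm (th : R) : 0 < th -> th < c ->
  mu.-integrable setT (EFin \o (fun y : R => `|y|)) /\
  mu.-integrable setT (EFin \o (fun y : R => expR (th * `|y|) - th * `|y|)).
Proof.
move=> th0 thc.
have mn : measurable_fun setT (fun y : R => th * `|y|).
  by apply: measurable_funM => //; exact: measurableT_comp.
pose psi (y : R) : R := expR (th * `|y|) - th * `|y|.
have ipsi : mu.-integrable setT (EFin \o psi).
  apply/integrableP; split.
    apply/measurable_EFinP; apply: measurable_funB => //.
    exact: measurableT_comp.
  under eq_integral => y _.
    rewrite gee0_abs; last first.
      rewrite /= lee_fin /psi; have := expR_ge1Dx (th * `|y|); lra.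
    over.
  by rewrite (le_lt_trans (integral_expR_norm_le _ _ _ (ltW th0) thc tail))//
      ltry.
split => //.
apply: (@le_integrable _ _ _ _ _ _ _
    (fun y => (th^-1)%:E * (EFin \o psi) y)%E) => //.
- by apply/measurable_EFinP; exact: measurableT_comp.
- move=> y _; rewrite /= lee_fin normr_id /psi.
  have h : th * `|y| <= expR (th * `|y|) - th * `|y|.
    by apply: le_expRB; rewrite mulr_ge0// ltW.
  have := ler_norm (th^-1 * (expR (th * `|y|) - th * `|y|)).
  apply: le_trans; rewrite mulrC ler_pdivlMr//; lra.
- exact: integrableZl.
Qed.

(* The linear term of [expR v <= v + (expR |v| - |v|)] integrates to zero at
   [v = a y - abar]; since [|v| <= b (|y| + m)] with [m] the mean of [|y|],
   convexity and the tangent at [2 b m] bound the rest by the mean of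
   [expR (2 b |y|) - 2 b |y|]. *)
Lemma mgf_lipschitz_le (a : R -> R) (b : R) : 0 < b -> 2 * b < c ->
  measurable_fun setT a -> (forall y z, `|a y - a z| <= b * `|y - z|) ->
  (\int[mu]_y (expR (a y))%:E
   <= (expR (\int[mu]_y a y)%R
       * (1 + 2 * (2 * b) ^+ 2 / (c * (c - 2 * b))))%:E)%E.
Proof.
move=> b0 bc ma alip.
have b20 : 0 < 2 * b by rewrite mulr_gt0.
have [inorm ipsi] := integrable_expR_norm (2 * b) b20 bc.
set psi := (fun y : R => expR (2 * b * `|y|) - 2 * b * `|y|) in ipsi.
have icst (k : R) : mu.-integrable setT (EFin \o (fun=> k)).
  exact: finite_measure_integrable_cst.
have inormZ (k : R) : mu.-integrable setT (EFin \o (fun y : R => k * `|y|)).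
  exact: (integrableZl _ k inorm).
have ia : mu.-integrable setT (EFin \o a).
  apply: (@le_integrable _ _ _ _ _ _ _
     (EFin \o (fun y : R => `|a 0| + b * `|y|))) => //.
  - exact/measurable_EFinP.
  - move=> y _; rewrite /= lee_fin.
    have := alip y 0; rewrite subr0.
    have := ler_normD (a y - a 0) (a 0); rewrite subrK.
    have := ler_norm (`|a 0| + b * `|y|); lra.
  - exact: (integrableD _ (icst `|a 0|) (inormZ b)).
pose m : R := (\int[mu]_y `|y|)%R.
pose abar : R := (\int[mu]_y a y)%R.
have one : fine (mu setT) = 1 by rewrite probability_setT.
(* The deviation from the mean is the average over an independent copy [z] of [a y - a z], bounded
   by [b (|y| + |z|)]. *)
have Vle y : `|a y - abar| <= b * `|y| + b * m.
  have -> : a y - abar = (\int[mu]_z (a y - a z))%R.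
    by rewrite RintegralB// Rintegral_cst// one mulr1.
  apply: (le_trans (le_normr_Rintegral _ _)) => //.
    exact: (integrableB _ (icst (a y)) ia).
  have -> : b * `|y| + b * m = (\int[mu]_z (b * `|y| + b * `|z|))%R.
    rewrite RintegralD//.
    by rewrite Rintegral_cst// one mulr1 RintegralZl.
  apply: le_Rintegral => //.
  - apply: (@eq_integrable _ _ _ _ _ _ (abse \o (EFin \o (fun z => a y - a
      z)))) => //.
    apply: integrable_abse.
    exact: (integrableB _ (icst (a y)) ia).
  - exact: (integrableD _ (icst (b * `|y|)) (inormZ b)).
  - move=> z _; rewrite -mulrDr (le_trans (alip _ _))// ler_pM2l//.
    exact: ler_normB.
have m0 : 0 <= m by apply: Rintegral_ge0.
(* [pm] and [k] are the value and the slope at [s = m] of [expR (2 b s) - 2 b s], so [pmE] is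
   Jensen's inequality through the tangent line. *)
pose pm := expR (2 * b * m) - 2 * b * m.
pose k := (expR (2 * b * m) - 1) * (2 * b).
have inm : mu.-integrable setT (EFin \o (fun y : R => `|y| - m)).
  exact: (integrableB _ inorm (icst m)).
have inmZ : mu.-integrable setT (EFin \o (fun y : R => k * (`|y| - m))).
  exact: (integrableZl _ k inm).
have pmE : pm <= (\int[mu]_y psi y)%R.
  have -> : pm = (\int[mu]_y (pm + k * (`|y| - m)))%R.
    rewrite RintegralD// Rintegral_cst// one mulr1 RintegralZl//.
    by rewrite RintegralB// Rintegral_cst// one mulr1 subrr mulr0 addr0.
  apply: le_Rintegral => //; first exact: (integrableD _ (icst pm) inmZ).
  move=> y _; rewrite /pm /psi /k.
  have -> : 2 * b * `|y| = 2 * b * m + 2 * b * (`|y| - m) by ring.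
  rewrite expRD.
  have := ler_wpM2l (expR_ge0 (2 * b * m)) (expR_ge1Dx (2 * b * (`|y| - m))).
  lra.
(* [h] is an integrable majorant of [expR (a y - abar)]: its first term has mean zero, and the mean
   of [pm / 2] is at most that of [psi / 2] by [pmE]. *)
pose h y := (a y - abar) + (psi y / 2 + pm / 2).
have ih1 : mu.-integrable setT (EFin \o (fun y => a y - abar)).
  exact: (integrableB _ ia (icst abar)).
have ih2 : mu.-integrable setT (EFin \o (fun y => psi y / 2)).
  exact: (integrableZr _ 2^-1 ipsi).
have ih3 : mu.-integrable setT (EFin \o (fun y => psi y / 2 + pm / 2)).
  exact: (integrableD _ ih2 (icst (pm / 2))).
have ih : mu.-integrable setT (EFin \o h) by exact: (integrableD _ ih1 ih3).
have hle y : expR (a y - abar) <= h y.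
  apply: (le_trans (expR_le_addB _)); rewrite lerD2l.
  apply: (le_trans (expRB_mono _ _ _ (Vle y))) => //.
  have := expR_mid (2 * b * `|y|) (2 * b * m).
  have -> : (2 * b * `|y| + 2 * b * m) / 2 = b * `|y| + b * m by field.
  rewrite /psi /pm; lra.
have hint : (\int[mu]_y h y)%R <= (\int[mu]_y psi y)%R.
  rewrite RintegralD// RintegralB// RintegralD// RintegralZr//.
  rewrite !Rintegral_cst// one !mulr1 -/abar; lra.
apply: (@le_trans _ _ ((expR abar)%:E * \int[mu]_y (h y)%:E)%E).
  rewrite -ge0_integralZl//=; last 2 first.
  - exact: (measurable_int _ ih).
  - by move=> y _; rewrite lee_fin (le_trans _ (hle y))// expR_ge0.
  apply: ge0_le_integral => //.
  - by apply/measurable_EFinP; exact: measurableT_comp.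
  - apply: measurable_funeM; exact: (measurable_int _ ih).
  - move=> y _; rewrite -EFinM lee_fin.
    have -> : a y = abar + (a y - abar) by ring.
    by rewrite expRD ler_pM2l ?expR_gt0.
have -> : (\int[mu]_y (h y)%:E = (\int[mu]_y h y)%R%:E)%E.
  by rewrite /Rintegral fineK//; exact: integrable_fin_num ih.
rewrite -EFinM lee_fin ler_pM2l ?expR_gt0// (le_trans hint)//.
rewrite -lee_fin /Rintegral fineK; last exact: integrable_fin_num ipsi.
apply: integral_expR_norm_le => //; lra.
Qed.

End exponential_tails.

(** * Tensorization of exponential moments *)

Section exponential_moment.
Context {R : realType} {d} {T : measurableType d} (P : probability T R)
  {n : nat} (X : 'I_n -> {RV P >-> R}) (mu : probability R R) (c b : R).
Hypothesis X_indep : mutually_independent X.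
Hypothesis X_law : forall i B, measurable B -> P (X i @^-1` B) = mu B.
Hypothesis tail : forall t : R, 0 <= t ->
  (mu [set y | (t < `|y|)%R] <= (2 * expR (- (c * t)))%:E)%E.
Hypotheses (b_gt0 : 0 < b) (bc : 2 * b < c).
Implicit Types (g : ('I_n -> R) -> R) (x y : 'I_n -> R) (k : 'I_n).

Definition lipschitz_l1 g := forall x y, `|g x - g y| <= b * l1dist x y.

Definition average k g x : R := \int[mu]_z g (upd x k z).

Lemma l1dist_upd x k (y z : R) : l1dist (upd x k y) (upd x k z) = `|y - z|.
Proof.
rewrite /l1dist (bigD1 k)//= big1 ?addr0; first by rewrite /upd eqxx.
by move=> i /negbTE ik; rewrite /upd ik subrr normr0.
Qed.

Lemma le_l1dist_upd x y k z : l1dist (upd x k z) (upd y k z) <= l1dist x y.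
Proof.
apply: ler_sum => i _; rewrite /upd; case: eqP => // _.
by rewrite subrr normr0.
Qed.

Lemma measurable_upd g x k : lipschitz_l1 g ->
  measurable_fun setT (fun z => g (upd x k z)).
Proof.
move=> glip; apply: (@measurable_l1lipschitz _ R R n (fun i z => upd x k z i) g
    b _ glip) => i.
by rewrite /upd; case: eqP.
Qed.

Lemma integrable_upd g x k : lipschitz_l1 g ->
  mu.-integrable setT (EFin \o (fun z => g (upd x k z))).
Proof.
move=> glip.
have [inorm _] := integrable_expR_norm mu c tail (2 * b) (mulr_gt0 (ltr0Sn R 1)
    b_gt0) bc.
have icst (r : R) : mu.-integrable setT (EFin \o (fun=> r)).
  exact: finite_measure_integrable_cst.
apply: (@le_integrable _ _ _ _ _ _ _
   (EFin \o (fun z : R => `|g (upd x k 0)| + b * `|z|))) => //.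
- by apply/measurable_EFinP; exact: measurable_upd.
- move=> z _; rewrite /= lee_fin.
  have := glip (upd x k z) (upd x k 0); rewrite l1dist_upd subr0.
  have := ler_normD (g (upd x k z) - g (upd x k 0)) (g (upd x k 0)); rewrite
      subrK.
  have := ler_norm (`|g (upd x k 0)| + b * `|z|); lra.
- exact: (integrableD _ (icst `|g (upd x k 0)|) (integrableZl _ b inorm)).
Qed.

(** Resampling both points with the same [z] does not increase their l1 distance. Keeping the
    constant [b] is what gives the same factor at each step of the induction. *)
Lemma average_lipschitz k g : lipschitz_l1 g -> lipschitz_l1 (average k g).
Proof.
move=> glip x y; rewrite /average -RintegralB//; try exact: integrable_upd.
have iB : mu.-integrable setT
    (EFin \o (fun z => g (upd x k z) - g (upd y k z))).
  exact: (integrableB _ (integrable_upd _ _ _ glip) (integrable_upd _ _ _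
      glip)).
apply: (le_trans (le_normr_Rintegral _ iB)) => //.
have -> : b * l1dist x y = (\int[mu]_z (b * l1dist x y))%R.
  have one : fine (mu setT) = 1 by rewrite probability_setT.
  by rewrite Rintegral_cst// one mulr1.
apply: le_Rintegral => //.
- exact: (@eq_integrable _ _ _ _ _ _ (abse \o (EFin \o (fun z => g (upd x k z)
    - g (upd y k z)))) _ _ (integrable_abse iB)).
- exact: finite_measure_integrable_cst.
- move=> z _; apply: (le_trans (glip _ _)).
  by rewrite ler_pM2l// le_l1dist_upd.
Qed.

Lemma measurable_integral_upd g k (phi : R -> R) : lipschitz_l1 g ->
  measurable_fun setT phi -> (forall r, 0 <= phi r) ->
  measurable_fun setT
    (fun w => \int[mu]_z (phi (g (upd (X ^~ w) k z)))%:E)%E.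
Proof.
move=> glip mphi phi0.
apply: (@measurable_fun_fubini_tonelli_F _ _ T R R mu
  (fun p : T * R => (phi (g (upd (X ^~ p.1) k p.2)))%:E)) => [|p].
  apply/measurable_EFinP; apply: measurableT_comp => //.
  apply: (measurable_l1lipschitz (fun i (p : T * R) => upd (X ^~ p.1) k p.2 i)
      g b) => // i.
  rewrite /upd; case: eqP => _; first exact: measurable_snd.
  by apply: (@measurableT_comp _ _ _ _ _ _ (X i : T -> R) _ fst).
by rewrite lee_fin.
Qed.

Lemma integral_average k g : lipschitz_l1 g -> (forall x, 0 <= g x) ->
  (\int[P]_w (average k g (X ^~ w))%:E = \int[P]_w (g (X ^~ w))%:E)%E.
Proof.
move=> glip g0.
(* [integral_resample] asks for a nonnegative function of [g]; the absolute value serves, as [g] is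
   nonnegative. *)
have normg x : g x = `|g x| by rewrite ger0_norm.
under [RHS]eq_integral do rewrite normg.
rewrite (@integral_resample _ _ _ P _ X mu X_indep X_law k g Num.norm b)//.
apply: eq_integral => w _; rewrite /average /Rintegral fineK.
  by apply: eq_integral => z _; rewrite -normg.
exact: integrable_fin_num (integrable_upd _ _ _ glip).
Qed.

Definition mgf_factor : R := 1 + 2 * (2 * b) ^+ 2 / (c * (c - 2 * b)).

Lemma mgf_factor_ge0 : 0 <= mgf_factor.
Proof.
rewrite /mgf_factor addr_ge0// divr_ge0//; first by rewrite mulr_ge0 ?sqr_ge0.
by rewrite mulr_ge0//; have := b_gt0; have := bc; lra.
Qed.

(** With the other coordinates frozen, [g] is a [b]-Lipschitz function of coordinate [k] with mean
    [average k g], so [mgf_lipschitz_le] applies inside the resampled integral. *)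
Lemma integral_expR_average k g : lipschitz_l1 g ->
  (\int[P]_w (expR (g (X ^~ w)))%:E
   <= mgf_factor%:E * \int[P]_w (expR (average k g (X ^~ w)))%:E)%E.
Proof.
move=> glip.
have mavg : measurable_fun setT (fun w => (expR (average k g (X ^~ w)))%:E).
  apply/measurable_EFinP; apply: measurableT_comp => //.
  apply: (measurable_l1lipschitz (fun i w => X i w) _ b) => //.
  exact: average_lipschitz.
rewrite (@integral_resample _ _ _ P _ X mu X_indep X_law k g expR b)//.
rewrite -ge0_integralZl//; last by rewrite lee_fin mgf_factor_ge0.
apply: ge0_le_integral => //.
- by move=> w _; apply: integral_ge0 => z _; rewrite lee_fin expR_ge0.
- apply: measurable_integral_upd => //; exact: expR_ge0.
- exact: measurable_funeM.
- move=> w _; rewrite -EFinM mulrC.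
  apply: (mgf_lipschitz_le mu c tail) => //.
    exact: measurable_upd.
  by move=> y z; rewrite (le_trans (glip _ _))// l1dist_upd.
Qed.

(** Induction on a list [s] of coordinates that determine [g]: averaging over the head keeps the
    mean, the sign and the Lipschitz constant, and leaves a function determined by the tail. At the
    end [g] is a constant, at most [m]. *)
Lemma integral_expR_le (s : seq 'I_n) g (m : R) : lipschitz_l1 g ->
  (forall x, 0 <= g x) ->
  (forall x y, (forall i, i \in s -> x i = y i) -> g x = g y) ->
  (\int[P]_w (g (X ^~ w))%:E <= m%:E)%E ->
  (\int[P]_w (expR (g (X ^~ w)))%:E <= (mgf_factor ^+ size s * expR m)%:E)%E.
Proof.
elim: s g => [|k s IHs] g glip g0 gs gm.
  have gE x : g x = g (fun=> 0) by apply: gs.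
  move: gm; under eq_integral do rewrite gE.
  under [in X in _ -> X]eq_integral do rewrite gE.
  rewrite !integral_cst//= probability_setT !mule1 !lee_fin mul1r => gm.
  by rewrite ler_expR.
apply: (le_trans (integral_expR_average k g glip)).
rewrite exprS -mulrA EFinM; apply: lee_pmul => //.
- by rewrite lee_fin mgf_factor_ge0.
- by apply: integral_ge0 => w _; rewrite lee_fin expR_ge0.
apply: IHs.
- exact: average_lipschitz.
- by move=> x; apply: Rintegral_ge0.
- move=> x y xy; apply: eq_Rintegral => z _; apply: gs => i.
  rewrite inE /upd; case: eqP => //= _; exact: xy.
- by rewrite integral_average.
Qed.

End exponential_moment.

(** * The quantile coupling *)

(** [|x - y|] is the length of the set of thresholds [t] separating [x] and [y]. With the same fact
    for levels [u] in [integral_dist_ge_bool], it lets Tonelli's theorem exchange quantiles and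
    CDFs. *)
Lemma integral_dist_le_bool {R : realType} (x y : R) :
  (\int[lebesgue_measure]_t (`|(x <= t)%R%:R - (y <= t)%R%:R|%R)%:E
   = (`|x - y|)%:E)%E.
Proof.
wlog xy : x y / x <= y => [hw|].
  have [xy|/ltW yx] := leP x y; first exact: hw.
  by rewrite distrC -hw//; under eq_integral do rewrite distrC.
transitivity (\int[lebesgue_measure]_t (\1_(`[x, y[%classic : set R) t)%:E)%E.
  apply: eq_integral => t _; rewrite indicE mem_setE in_itv /=.
  have [ty|yt] := leP y t; first by rewrite (le_trans xy ty) subrr normr0.
  by rewrite subr0 andbT; case: (x <= t); rewrite ?normr1 ?normr0.
rewrite integral_indic//= setIT lebesgue_measure_itv/= lte_fin.
rewrite ler0_norm ?subr_le0// opprB.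
case: ltP => [_|yx]; first by rewrite -EFinB.
by rewrite (_ : x = y) ?subrr//; apply/le_anti; rewrite xy yx.
Qed.

Lemma integral_dist_ge_bool {R : realType} (a b : R) :
  0 <= a <= 1 -> 0 <= b <= 1 ->
  (\int[lebesgue_measure]_(u in `]0%R, 1%R[)
     (`|(u <= a)%R%:R - (u <= b)%R%:R|%R)%:E = (`|a - b|)%:E)%E.
Proof.
wlog ab : a b / a <= b => [hw|] a01 b01.
  have [ab|/ltW ba] := leP a b; first exact: hw.
  by rewrite distrC -hw//; under eq_integral do rewrite distrC.
have /andP[a0 a1] := a01; have /andP[b0 b1] := b01.
transitivity (\int[lebesgue_measure]_(u in `]0%R, 1%R[)
    (\1_(`]a, b]%classic : set R) u)%:E)%E.
  apply: eq_integral => u _; rewrite indicE mem_setE in_itv /=.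
  have [ua|au] := leP u a; first by rewrite (le_trans ua ab) subrr normr0.
  by rewrite sub0r normrN /=; case: (u <= b); rewrite ?normr1 ?normr0.
rewrite integral_indic//=.
have -> : `|a - b| = b - a by rewrite ler0_norm ?subr_le0// opprB.
(* Levels range over an open interval, so at [b = 1] the right endpoint drops out of the
   intersection. *)
have [b_lt1|b_ge1] := ltP b 1.
  rewrite (_ : _ `&` _ = `]a, b]%classic); last first.
    apply/seteqP; split => u /=; rewrite !in_itv /=; first by case.
    move=> /andP[au ub]; split; apply/andP; split => //.
      exact: le_lt_trans au.
    exact: le_lt_trans b_lt1.
  rewrite lebesgue_measure_itv/= lte_fin.
  case: ltP => [_|ba]; first by rewrite -EFinB.
  by rewrite (_ : a = b) ?subrr//; apply/le_anti; rewrite ab ba.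
have -> : b = 1 by apply/le_anti; rewrite b1 b_ge1.
rewrite (_ : _ `&` _ = `]a, 1[%classic); last first.
  apply/seteqP; split => u /=; rewrite !in_itv /=.
    by move=> [/andP[-> _]] /andP[_ ->].
  move=> /andP[au u1]; split; apply/andP; split => //; first exact: ltW.
  exact: le_lt_trans au.
rewrite lebesgue_measure_itv/= lte_fin.
case: ltP => [_|ba]; first by rewrite -EFinB.
by rewrite (_ : a = 1) ?subrr//; apply/le_anti; rewrite a1 ba.
Qed.

Lemma integral_uniform01 {R : realType} (f : R -> \bar R) :
  measurable_fun setT f -> (forall x, 0 <= f x)%E ->
  (\int[uniform_prob (@ltr01 R)]_u f u
   = \int[lebesgue_measure]_(u in `]0%R, 1%R[) f u)%E.
Proof.
move=> mf f0; rewrite integral_uniform// subr0 invr1 mul1e.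
by apply: integral_itv_bndoo; exact: measurable_funTS.
Qed.

Section quantile.
Context {R : realType}.
Implicit Type F : CDF R.

Lemma cdf_range F t : 0 <= F t <= 1.
Proof.
apply/andP; split.
  rewrite leNgt; apply/negP => Ft0.
  have /cvgrPdist_lt/(_ (- F t)) := cumulativeNy F.
  rewrite oppr_gt0 => /(_ Ft0) [M [_ MF]].
  have := MF (Num.min t (M - 1)); rewrite sub0r normrN.
  have h : Num.min t (M - 1) < M by rewrite gt_min; apply/orP; right; lra.
  move=> /(_ h).
  have h1 : F (Num.min t (M - 1)) <= F t.
    by apply: (cumulative_is_nondecreasing F); rewrite ge_min lexx.
  rewrite ltr0_norm => [?|]; lra.
rewrite leNgt; apply/negP => Ft1.
have /cvgrPdist_lt/(_ (F t - 1)) := cumulativey F.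
rewrite subr_gt0 => /(_ Ft1) [M [_ MF]].
have := MF (Num.max t (M + 1)).
have h : M < Num.max t (M + 1) by rewrite lt_max; apply/orP; right; lra.
move=> /(_ h).
have h1 : F t <= F (Num.max t (M + 1)).
  by apply: (cumulative_is_nondecreasing F); rewrite le_max lexx.
rewrite ltr0_norm => [?|]; lra.
Qed.

(** For [u] outside [0 < u < 1] the set can be empty or unbounded below; the default [0] makes the
    function total, on levels that are null for the uniform law. *)
Definition quantile F (u : R) : R :=
  if 0 < u < 1 then inf [set t | u <= F t] else 0.

(** The Galois connection between a CDF and its quantile function; right-continuity of [F] means
    that the infimum is attained. *)
Lemma quantile_le F (u t : R) : 0 < u < 1 -> (quantile F u <= t) = (u <= F t).
Proof.
move=> u01; rewrite /quantile u01; have /andP[u0 u1] := u01.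
set S := [set t | u <= F t].
have S0 : S !=set0.
  have /cvgrPdist_lt/(_ (1 - u)) := cumulativey F.
  rewrite subr_gt0 => /(_ u1) [M [_ MF]].
  exists (M + 1); have := MF (M + 1); rewrite ltrDl => /(_ ltr01) /=.
  by have := ler_norm (1 - F (M + 1)); rewrite /S /=; lra.
have lS : has_lbound S.
  have /cvgrPdist_lt/(_ u u0) := cumulativeNy F.
  move=> [M [_ MF]]; exists (M - 1) => s /= us; rewrite leNgt; apply/negP => sM.
  have := MF s; rewrite sub0r normrN.
  have h : s < M by lra.
  move=> /(_ h); have : u <= F s := us; have := ler_norm (F s); lra.
apply/idP/idP => [qt|ut]; last exact: (ge_inf lS).
(* If [F t < u], right-continuity keeps [F] below [u] just after [t], yet an infimum at most [t]
   forces a point of [S] there. *)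
rewrite leNgt; apply/negP => Ftu.
have := cumulative_is_right_continuous F t.
move=> /cvgrPdist_lt/(_ (u - F t)); rewrite subr_gt0 => /(_ Ftu).
move=> [e /= e0 eF].
have [s us st] : exists2 s, S s & s < t + e.
  by apply: inf_lt => //; rewrite (le_lt_trans qt)// ltrDl.
have Fst : F t < F s by exact: lt_le_trans us.
have ts : t < s.
  rewrite ltNge; apply/negP => /(cumulative_is_nondecreasing F s t).
  by rewrite leNgt Fst.
have h : `|t - s| < e by rewrite ltr0_norm ?subr_lt0//; lra.
have := eF s h ts; rewrite ltr0_norm ?subr_lt0// opprB => h1.
by have us' : u <= F s := us; lra.
Qed.

Lemma measurable_quantile F : measurable_fun setT (quantile F).
Proof.
apply: (measurability _ (RGenOInfty.measurableE R)) => //.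
move=> _ [_ [t ->] <-]; rewrite setTI set_itvoy.
(* Levels outside the unit interval have quantile [0], hence enter exactly when [t < 0]. *)
have -> : quantile F @^-1` [set x | t < x] =
    (`]0, 1[%classic `&` `]F t, +oo[%classic) `|`
    (if t < 0 then ~` `]0, 1[%classic else set0).
  apply/seteqP; split => u /=.
  - have [u01 tq|nu01] := boolP (0 < u < 1).
      left; split; first by rewrite in_itv.
      by rewrite in_itv /= andbT ltNge -quantile_le// -ltNge.
    by rewrite /quantile (negbTE nu01) => ->; right; rewrite /= in_itv /=;
        exact/negP.
  - move=> [[]|].
      rewrite !in_itv /= andbT => u01.
      by rewrite ltNge -quantile_le// -ltNge.
    case: ifP => //= t0; rewrite in_itv /= => /negP/negbTE nu.
    by rewrite /quantile nu.
apply: measurableU; first exact: measurableI.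
by case: ifP => // _; exact: measurableC.
Qed.

(** Both quantile functions are applied to one uniform variable. The cost is written as an integral
    over thresholds [t], the two integrals are exchanged, and [quantile_le] turns
    [quantile F u <= t] into [u <= F t], whose integral over [u] gives [|F t - G t|]. *)
Lemma W1_le_integral F G :
  (W1 F G <= \int[lebesgue_measure]_t (`|F t - G t|)%:E)%E.
Proof.
pose U := uniform_prob (@ltr01 R).
pose Q u := (quantile F u, quantile G u).
have mQ : measurable_fun setT Q.
  by apply: measurable_fun_pair; exact: measurable_quantile.
pose Qm : {mfun measurableTypeR R >-> (R * R)%type} :=
  HB.pack (Q : measurableTypeR R -> R * R)
    (isMeasurableFun.Build _ _ (measurableTypeR R) (R * R)%type Q mQ).
have mle H t : measurable_fun setT (fun u : R => quantile H u <= t).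
  by apply: measurable_fun_ler => //; exact: measurable_quantile.
have marginal H t : U [set u | quantile H u <= t] = (H t)%:E.
  transitivity (\int[U]_u ((quantile H u <= t)%R%:R : R)%:E)%E.
    by rewrite (integral_natr_bool U _ (mle H t)).
  rewrite integral_uniform01//; last first.
    by apply/measurable_EFinP; apply: measurable_natr_bool; exact: mle.
  (* Taking [b = 0] kills the second indicator, since no level in the open unit interval satisfies
     [u <= 0]. *)
  have := integral_dist_ge_bool (H t) 0 (cdf_range H t).
  rewrite lexx ler01 => /(_ isT).
  have /andP[H0 _] := cdf_range H t; rewrite subr0 (ger0_norm H0) => <-.
  apply: eq_integral => u; rewrite inE /= in_itv /= => u01.
  rewrite quantile_le//; have /andP[u0 _] := u01.
  by rewrite [u <= 0]leNgt u0 subr0; case: (u <= H t); rewrite ?normr1 ?normr0.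
have cpl : coupling F G (distribution U Qm).
  split => t; rewrite /distribution /pushforward.
  - rewrite -(marginal F t); congr (U _); apply/seteqP.
    by split => u /=; rewrite in_itv /= => // -[].
  - rewrite -(marginal G t); congr (U _); apply/seteqP.
    by split => u /=; rewrite in_itv /= => // -[].
have mcost : measurable_fun setT (fun z : R * R => (`|z.1 - z.2|)%:E).
  apply/measurable_EFinP; apply: measurableT_comp => //.
  exact: measurable_funB.
apply: (@le_trans _ _ (\int[distribution U Qm]_z (`|z.1 - z.2|)%:E)%E).
  by apply: ereal_inf_lbound; exists (distribution U Qm).
rewrite ge0_integral_distribution//.
pose k (p : measurableTypeR R * measurableTypeR R) : \bar R :=
  (`|(quantile F p.1 <= p.2)%R%:R - (quantile G p.1 <= p.2)%R%:R|%R)%:E.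
have mk : measurable_fun setT k.
  have mkH H : measurable_fun setT
      (fun p : measurableTypeR R * measurableTypeR R => (quantile H p.1 <=
          p.2)%R%:R : R).
    apply: measurable_natr_bool; apply: measurable_fun_ler => //.
    by apply: (@measurableT_comp _ _ _ _ _ _ (quantile H) _ fst) => //;
      exact: measurable_quantile.
  apply/measurable_EFinP; apply: measurableT_comp => //.
  by apply: measurable_funB; exact: mkH.
have -> : (\int[U]_u (`|(Q u).1 - (Q u).2|)%:E
    = \int[U]_u \int[lebesgue_measure]_t k (u, t))%E.
  by apply: eq_integral => u _; rewrite -integral_dist_le_bool.
rewrite (fubini_tonelli k)//; last by move=> p; rewrite lee_fin.
rewrite le_eqVlt; apply/orP; left; apply/eqP; apply: eq_integral => t _.
rewrite integral_uniform01; last 2 first.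
- apply/measurable_EFinP; apply: measurableT_comp => //.
  by apply: measurable_funB; apply: measurable_natr_bool; exact: mle.
- by move=> u; rewrite lee_fin.
rewrite -integral_dist_ge_bool ?cdf_range//.
by apply: eq_integral => u; rewrite inE /= in_itv /= => u01; rewrite /k /=
    !quantile_le.
Qed.

End quantile.

(** * The distance from the empirical CDF to a CDF *)

Lemma integral_expR_decay_norm {R : realType} (k : R) : 0 < k ->
  (\int[lebesgue_measure]_t (expR (- (k * `|t|)))%:E = (2 / k)%:E)%E.
Proof.
move=> k0; rewrite (ge0_symfun_integralT (f := fun t : R => expR (- (k *
    `|t|)))).
- rewrite EFinM -(integral_expR_decay _ k0); congr (_ * _)%E.
  rewrite -set_itvcy; apply: eq_integral => t.
  by rewrite inE /= in_itv /= andbT => t0; rewrite ger0_norm.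
- by move=> t; exact: expR_ge0.
- move=> t; apply: continuous_comp; last exact: continuous_expR.
  apply: continuousN; apply: continuousM; first exact: cst_continuous.
  exact: norm_continuous.
- by move=> t /=; rewrite normrN.
Qed.

Lemma empirical_cdf_fun_dist_le {R : realType} {n : nat} (x y : 'I_n -> R) (t :
    R) :
  `|empirical_cdf_fun x t - empirical_cdf_fun y t| <=
  n%:R^-1 * \sum_(i < n) `|(x i <= t)%R%:R - (y i <= t)%R%:R|.
Proof.
rewrite /empirical_cdf_fun -mulrBr normrM ger0_norm// ler_wpM2l//.
by rewrite -sumrB; exact: ler_norm_sum.
Qed.

Lemma measurable_empirical_cdf_fun {d} {A : measurableType d} {R : realType}
    {n : nat} (u : 'I_n -> A -> R) (v : A -> R) :
  (forall i, measurable_fun setT (u i)) -> measurable_fun setT v ->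
  measurable_fun setT (fun w => empirical_cdf_fun (u ^~ w) (v w)).
Proof.
move=> mu mv; apply: measurable_funM => //; apply: measurable_sum => i.
by apply: measurable_natr_bool; exact: measurable_fun_ler.
Qed.

Lemma integral_empirical_cdf_fun_dist_le {R : realType} {n : nat} (x y : 'I_n
    -> R) :
  (\int[lebesgue_measure]_t (`|empirical_cdf_fun x t - empirical_cdf_fun y
      t|)%:E
   <= (n%:R^-1 * l1dist x y)%:E)%E.
Proof.
have mb (z : R) : measurable_fun setT (fun t : R => (z <= t)%R%:R : R).
  by apply: measurable_natr_bool; exact: measurable_fun_ler.
have md i : measurable_fun setT
    (fun t : R => `|(x i <= t)%R%:R - (y i <= t)%R%:R| : R).
  by apply: measurableT_comp => //; exact: measurable_funB.
apply: (@le_trans _ _ (\int[lebesgue_measure]_t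
    (n%:R^-1%:E * \sum_(i < n) (`|(x i <= t)%R%:R - (y i <= t)%R%:R|%R)%:E))%E).
  apply: ge0_le_integral => //.
  - apply/measurable_EFinP; apply: measurableT_comp => //.
    by apply: measurable_funB; apply: measurable_empirical_cdf_fun => //.
  - apply: measurable_funeM; apply: emeasurable_sum => i.
    by apply/measurable_EFinP; exact: md.
  - move=> t _; rewrite sumEFin -EFinM lee_fin.
    exact: empirical_cdf_fun_dist_le.
rewrite ge0_integralZl//; last 2 first.
- by apply: emeasurable_sum => i; apply/measurable_EFinP; exact: md.
- by move=> t _; rewrite sume_ge0// => i _; rewrite lee_fin.
rewrite EFinM; apply: lee_pmul => //.
  by apply: integral_ge0 => t _; rewrite sume_ge0// => i _; rewrite lee_fin.
rewrite ge0_integral_sum//; last by move=> i; apply/measurable_EFinP; exact: md.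
rewrite /l1dist -sumEFin; apply: lee_sum => i _.
by rewrite integral_dist_le_bool.
Qed.

Section cdf_distance.
Context {R : realType} {n : nat} (F : CDF R) (c : R).
Hypotheses (n_gt0 : (0 < n)%N) (c_gt0 : 0 < c).
Hypothesis F_tail : forall t, `|(0 <= t)%R%:R - F t| <= expR (- (c * `|t|)).
Implicit Types x y : 'I_n -> R.
Local Notation leb := (@lebesgue_measure R).

Lemma measurable_cdf : measurable_fun setT F.
Proof.
by apply: nondecreasing_measurable => //; exact: cumulative_is_nondecreasing.
Qed.

(** Compare through the sample with all entries [0], whose empirical CDF is the unit step at [0]: it
    is at finite distance from that of [x], and [F_tail] bounds its distance to [F]. *)
Lemma integrable_empirical_cdf_dist x :
  leb.-integrable setT (EFin \o (fun t : R => `|empirical_cdf_fun x t - F t|)).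
Proof.
have nn : n%:R != 0 :> R by rewrite pnatr_eq0 -lt0n.
have memp y : measurable_fun setT (fun t : R => empirical_cdf_fun y t).
  exact: measurable_empirical_cdf_fun.
have mF := measurable_cdf.
have e0 t : empirical_cdf_fun (fun _ : 'I_n => 0) t = (0 <= t)%R%:R :> R.
  rewrite /empirical_cdf_fun sumr_const card_ord -[X in _ * X]mulr_natr.
  by rewrite mulrCA mulVf// mulr1.
have iexp : leb.-integrable setT (EFin \o (fun t : R => expR (- (c * `|t|)))).
  apply/integrableP; split.
    apply/measurable_EFinP; apply: measurableT_comp => //.
    by apply: measurable_funN; apply: measurable_funM.
  under eq_integral do rewrite /= ger0_norm ?expR_ge0//.
  by rewrite integral_expR_decay_norm// ltry.
have id0 : leb.-integrable setT
    (EFin \o (fun t : R => `|empirical_cdf_fun x t - empirical_cdf_fun (fun _ :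
        'I_n => 0) t|)).
  apply/integrableP; split.
    apply/measurable_EFinP; apply: measurableT_comp => //.
    apply: measurable_funB; first [exact: memp|exact: mF].
  under eq_integral do rewrite /= normr_id.
  by rewrite (le_lt_trans (integral_empirical_cdf_fun_dist_le _ _))// ltry.
apply: (le_integrable _ _ _ (integrableD _ id0 iexp)) => //.
  apply/measurable_EFinP; apply: measurableT_comp => //.
  apply: measurable_funB; first [exact: memp|exact: mF].
move=> t _; rewrite /= lee_fin normr_id.
apply: le_trans (ler_norm _).
apply: (le_trans (ler_distD (empirical_cdf_fun (fun _ : 'I_n => 0) t) _ _)).
by rewrite lerD2l e0.
Qed.

Definition cdf_dist x : R := \int[leb]_t `|empirical_cdf_fun x t - F t|.

Lemma cdf_distE x :
  (cdf_dist x)%:E = (\int[leb]_t (`|empirical_cdf_fun x t - F t|)%:E)%E.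
Proof.
rewrite /cdf_dist /Rintegral fineK//.
exact: integrable_fin_num (integrable_empirical_cdf_dist x).
Qed.

Lemma cdf_dist_ge0 x : 0 <= cdf_dist x.
Proof. by apply: Rintegral_ge0. Qed.

Lemma cdf_dist_le x y : cdf_dist x <= n%:R^-1 * l1dist x y + cdf_dist y.
Proof.
have memp z : measurable_fun setT (fun t : R => empirical_cdf_fun z t).
  exact: measurable_empirical_cdf_fun.
have mF := measurable_cdf.
rewrite -lee_fin EFinD !cdf_distE.
apply: le_trans; last first.
  by apply: leeD2r; exact: integral_empirical_cdf_fun_dist_le.
rewrite -ge0_integralD//; last 2 first.
- by apply/measurable_EFinP; apply: measurableT_comp => //; apply:
    measurable_funB; first [exact: memp|exact: mF].
- by apply/measurable_EFinP; apply: measurableT_comp => //; apply: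
    measurable_funB; first [exact: memp|exact: mF].
apply: ge0_le_integral => //.
- by apply/measurable_EFinP; apply: measurableT_comp => //; apply:
    measurable_funB; first [exact: memp|exact: mF].
- apply: emeasurable_funD; apply/measurable_EFinP; apply: measurableT_comp =>
    //;
    apply: measurable_funB; first [exact: memp|exact: mF].
- by move=> t _; rewrite -EFinD lee_fin; exact: ler_distD.
Qed.

Lemma cdf_dist_lipschitz x y :
  `|cdf_dist x - cdf_dist y| <= n%:R^-1 * l1dist x y.
Proof.
have h1 := cdf_dist_le x y; have h2 := cdf_dist_le y x.
rewrite l1distC in h2; rewrite ler_norml; lra.
Qed.

End cdf_distance.

(** * The mean distance, from the pointwise variance of the empirical CDF *)

Section mean_cdf_distance.
Context {R : realType} {d} {T : measurableType d} (P : probability T R)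
  {n : nat} (X : 'I_n -> {RV P >-> R}).
Hypotheses (n_gt0 : (0 < n)%N) (X_indep : mutually_independent X).
Local Notation leb := (@lebesgue_measure R).

(** The binomial variance, computed from the first two moments of the number [S] of sample points at
    most [t]. *)
Lemma variance_empirical_cdf (t p : R) : 0 <= p ->
  (forall i, P [set w | X i w <= t] = p%:E) ->
  (\int[P]_w ((empirical_cdf_fun (X ^~ w) t - p) ^+ 2)%:E
   = (n%:R^-1 * (p - p ^+ 2))%:E)%E.
Proof.
move=> p0 Xp.
have nn : n%:R != 0 :> R by rewrite pnatr_eq0 -lt0n.
pose I i w : R := (X i w <= t)%R%:R.
pose S w : R := \sum_(i < n) I i w.
have mb i : measurable_fun setT (fun w => X i w <= t) by exact:
    measurable_fun_ler.
have mI i : measurable_fun setT (I i) by exact: measurable_natr_bool.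
have mS : measurable_fun setT S by apply: measurable_sum.
have I0 i w : 0 <= I i w by [].
have S0 w : 0 <= S w by apply: sumr_ge0.
have intI i : (\int[P]_w (I i w)%:E = p%:E)%E.
  exact: (etrans (integral_natr_bool P _ (mb i)) (Xp i)).
have intII i j : (\int[P]_w (I i w * I j w)%:E
    = (p ^+ 2 + (i == j)%:R * (p - p ^+ 2))%:E)%E.
  have [->|ij] := eqVneq i j.
    rewrite mul1r addrC subrK -(intI j); apply: eq_integral => w _.
    by rewrite /I; case: (X j w <= t); rewrite ?mulr1 ?mulr0.
  rewrite mul0r addr0.
  transitivity (\int[P]_w (((X i w <= t) && (X j w <= t))%:R : R)%:E)%E.
    apply: eq_integral => w _.
    by rewrite /I; case: (X i w <= t); case: (X j w <= t); rewrite ?mulr1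
        ?mulr0.
  rewrite integral_natr_bool; last exact: measurable_and.
  have := X_indep [set i; j]%SET (fun=> `]-oo, t]%classic).
  rewrite (_ : \bigcap_(k in _) _ = [set w | (X i w <= t) && (X j w <= t)]).
    move=> /(_ (fun=> measurable_itv _)) h; apply: (etrans h).
    rewrite big_setU1 ?inE//= big_set1.
    have Xp' k : P (X k @^-1` `]-oo, t]) = p%:E.
      by rewrite -(Xp k); congr (P _); apply/seteqP; split => w /=; rewrite
          in_itv.
    by rewrite !Xp' -EFinM expr2.
  apply/seteqP; split => w /=.
    move=> h; apply/andP; split.
      by have := h i; rewrite /= in_itv /= !inE eqxx; exact.
    by have := h j; rewrite /= in_itv /= !inE eqxx orbT; exact.
  by move=> /andP[hi hj] k /=; rewrite in_itv /= !inE => /orP[] /eqP ->.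
have intS : (\int[P]_w (S w)%:E = (n%:R * p)%:E)%E.
  under eq_integral do rewrite /S -sumEFin.
  rewrite ge0_integral_sum//; last 2 first.
  - by move=> i; apply/measurable_EFinP; exact: mI.
  - by move=> i w _; rewrite lee_fin.
  under eq_bigr do rewrite intI.
  by rewrite sumEFin sumr_const card_ord mulr_natl.
have intSS : (\int[P]_w (S w ^+ 2)%:E
    = (n%:R * (n%:R * p ^+ 2 + (p - p ^+ 2)))%:E)%E.
  have SS w : (S w ^+ 2)%:E = (\sum_(i < n) \sum_(j < n) (I i w * I j w)%:E)%E.
    rewrite expr2 /S big_distrlr /= -sumEFin; apply: eq_bigr => i _.
    by rewrite sumEFin.
  under eq_integral do rewrite SS.
  have mII i j : measurable_fun setT (fun w => (I i w * I j w)%:E).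
    by apply/measurable_EFinP; apply: measurable_funM; exact: mI.
  rewrite ge0_integral_sum//; last 2 first.
  - by move=> i; apply: emeasurable_sum => j; exact: mII.
  - by move=> i w _; apply: sume_ge0 => j _; rewrite lee_fin mulr_ge0.
  transitivity (\sum_(i < n) (n%:R * p ^+ 2 + (p - p ^+ 2))%:E)%E; last first.
    by rewrite sumEFin sumr_const card_ord -[X in X%:E = _]mulr_natl.
  apply: eq_bigr => i _.
  rewrite ge0_integral_sum//; last by move=> j w _; rewrite lee_fin mulr_ge0.
  under eq_bigr do rewrite intII.
  rewrite sumEFin big_split /= sumr_const card_ord -[X in X + _]mulr_natl;
      congr ((_ + _)%:E).
  rewrite (bigD1 i)//= eqxx mul1r big1 ?addr0// => j.
  by rewrite eq_sym => /negbTE ->; rewrite mul0r.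
have scale w : (empirical_cdf_fun (X ^~ w) t - p) ^+ 2
    = n%:R^-1 ^+ 2 * (S w - n%:R * p) ^+ 2.
  by rewrite -exprMn mulrBr mulKf.
have mD : measurable_fun setT (fun w => ((S w - n%:R * p) ^+ 2)%:E).
  by apply/measurable_EFinP; apply: measurable_funX; exact: measurable_funB.
under eq_integral do rewrite scale EFinM.
rewrite ge0_integralZl//; last by move=> w _; rewrite lee_fin sqr_ge0.
set V := (\int[P]_w _)%E.
(* The square is expanded as [(S - np)^2 + 2np S = S^2 + (np)^2], so that only nonnegative functions
   are integrated; the finite cross term is subtracted afterwards. *)
have : (V + (2 * n%:R * p)%:E * (n%:R * p)%:E
    = (n%:R * (n%:R * p ^+ 2 + (p - p ^+ 2)))%:E + ((n%:R * p) ^+ 2)%:E)%E.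
  have mSE : measurable_fun setT (fun w => (S w)%:E) by apply/measurable_EFinP;
      exact: mS.
  have mSSE : measurable_fun setT (fun w => (S w ^+ 2)%:E).
    by apply/measurable_EFinP; apply: measurable_funX; exact: mS.
  rewrite -intSS -intS -ge0_integralZl//; last 2 first.
  - by move=> w _; rewrite lee_fin.
  - by rewrite lee_fin !mulr_ge0.
  rewrite /V -ge0_integralD//; last 3 first.
  - by move=> w _; rewrite lee_fin sqr_ge0.
  - by move=> w _; rewrite lee_fin !mulr_ge0.
  - by apply: measurable_funeM; exact/measurable_EFinP.
  have -> : (((n%:R * p) ^+ 2)%:E = \int[P]_w ((n%:R * p) ^+ 2)%:E)%E.
    by rewrite integral_cst//= probability_setT mule1.
  rewrite -ge0_integralD//; last 2 first.
  - by move=> w _; rewrite lee_fin sqr_ge0.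
  - by move=> w _; rewrite lee_fin sqr_ge0.
  by apply: eq_integral => w _; rewrite -EFinM -!EFinD; congr (_%:E); ring.
move=> /(congr1 (fun x => x - (2 * n%:R * p * (n%:R * p))%:E)%E).
rewrite -!EFinM addeK// -EFinD.
move=> ->.
by rewrite -EFinM; congr (_%:E); field.
Qed.

(** At each [t] the mean deviation is at most [n^(-1/2) expR (- c |t| / 2)], the square root of the
    variance bound; integrating over [t] gives [2 / (c / 2) = 4 / c]. *)
Lemma mean_cdf_dist_le (F : CDF R) (c : R) : 0 < c ->
  (forall i t, P [set w | X i w <= t] = (F t)%:E) ->
  (forall t, F t - F t ^+ 2 <= expR (- (c * `|t|))) ->
  (\int[P]_w \int[leb]_t (`|empirical_cdf_fun (X ^~ w) t - F t|)%:E
   <= (4 / (c * Num.sqrt n%:R))%:E)%E.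
Proof.
move=> c0 XF Ftail.
have F0 t : 0 <= F t by have /andP[] := cdf_range F t.
pose k (q : T * measurableTypeR R) : \bar R :=
  (`|empirical_cdf_fun (X ^~ q.1) q.2 - F q.2|)%:E.
have mk : measurable_fun setT k.
  apply/measurable_EFinP; apply: measurableT_comp => //; apply: measurable_funB.
    apply: (measurable_empirical_cdf_fun (fun i (q : T * measurableTypeR R) =>
        X i q.1)) => // i.
    by apply: (@measurableT_comp _ _ _ _ _ _ (X i : T -> R) _ fst).
  apply: (@measurableT_comp _ _ _ _ _ _ (F : R -> R) _ snd) => //.
  exact: measurable_cdf.
have k0 q : (0 <= k q)%E by rewrite lee_fin.
rewrite (fubini_tonelli k)//.
have sn : 0 < Num.sqrt n%:R :> R by rewrite sqrtr_gt0 ltr0n.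
have c20 : 0 < c / 2 by rewrite divr_gt0.
have -> : (4 / (c * Num.sqrt n%:R))%:E = ((Num.sqrt n%:R)^-1%:E *
    \int[leb]_t (expR (- (c / 2 * `|t|)))%:E)%E.
  rewrite integral_expR_decay_norm// -EFinM; congr (_%:E).
  by field; rewrite !gt_eqF.
rewrite -ge0_integralZl//; last first.
  apply/measurable_EFinP; apply: measurableT_comp => //.
  by apply: measurable_funN; apply: measurable_funM.
apply: ge0_le_integral => //.
- by move=> t _; apply: integral_ge0 => w _; rewrite lee_fin.
- exact: (@measurable_fun_fubini_tonelli_G _ _ _ _ _ _ k).
- apply: measurable_funeM; apply/measurable_EFinP; apply: measurableT_comp =>
    //.
  by apply: measurable_funN; apply: measurable_funM.
move=> t _; rewrite -EFinM.
(* [r] is chosen so that [r^2] dominates the variance; the two halves of the bound below then add up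
   to [r]. *)
set r := (Num.sqrt n%:R)^-1 * expR (- (c / 2 * `|t|)).
have r0 : 0 < r by rewrite mulr_gt0 ?invr_gt0 ?expR_gt0.
have mD : measurable_fun setT (fun w => empirical_cdf_fun (X ^~ w) t - F t).
  apply: measurable_funB => //.
  by apply: (measurable_empirical_cdf_fun (fun i w => X i w)).
(* AM-GM: [|a| <= a^2 / (2 r) + r / 2] turns the second moment into [r] *)
apply: (@le_trans _ _ (\int[P]_w ((2 * r)^-1%:E *
   ((empirical_cdf_fun (X ^~ w) t - F t) ^+ 2)%:E + (r / 2)%:E))%E).
  apply: ge0_le_integral => //.
  - by apply/measurable_EFinP; apply: measurableT_comp => //.
  - apply: emeasurable_funD => //; apply: measurable_funeM.
    by apply/measurable_EFinP; exact: measurable_funX.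
  - move=> w _; rewrite -EFinM -EFinD lee_fin /k /=.
    set a := empirical_cdf_fun _ _ - _.
    have -> : (2 * r)^-1 * a ^+ 2 + r / 2 = (a ^+ 2 + r ^+ 2) / (2 * r).
      by field; rewrite gt_eqF.
    have a2 : `|a| ^+ 2 = a ^+ 2 by rewrite -normrX ger0_norm ?sqr_ge0.
    have r20 : 0 < 2 * r by rewrite mulr_gt0.
    rewrite ler_pdivlMr// -a2.
    have := sqr_ge0 (`|a| - r); lra.
have r2V : 0 <= (2 * r)^-1 by rewrite invr_ge0 mulr_ge0// ltW.
have mD2 : measurable_fun setT
    (fun w => ((empirical_cdf_fun (X ^~ w) t - F t) ^+ 2)%:E).
  by apply/measurable_EFinP; exact: measurable_funX.
rewrite ge0_integralD//; last 3 first.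
- by move=> w _; rewrite -EFinM lee_fin mulr_ge0 ?sqr_ge0.
- exact: measurable_funeM.
- by move=> w _; rewrite lee_fin divr_ge0// ltW.
rewrite ge0_integralZl//; last by move=> w _; rewrite lee_fin sqr_ge0.
rewrite (variance_empirical_cdf t (F t))//.
rewrite integral_cst//= probability_setT mule1 -EFinM -EFinD lee_fin.
have r2 : r ^+ 2 = n%:R^-1 * expR (- (c * `|t|)).
  rewrite /r exprMn exprVn sqr_sqrtr// -expRM_natl.
  by congr (_ * expR _); field.
have le_r2 : n%:R^-1 * (F t - F t ^+ 2) <= r ^+ 2.
  by rewrite r2 ler_wpM2l.
have rE : (2 * r)^-1 * r ^+ 2 + r / 2 = r by field; rewrite gt_eqF.
by rewrite -[leRHS]rE lerD2r ler_wpM2l.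
Qed.

End mean_cdf_distance.

(** * The deviation inequality *)

Lemma exponential_markov {d} {T : measurableType d} {R : realType}
    (P : probability T R) (h : T -> R) (E : set T) (a : R) :
  measurable E -> measurable_fun setT h -> (forall w, E w -> a <= h w) ->
  (P E <= (expR (- a))%:E * \int[P]_w (expR (h w))%:E)%E.
Proof.
move=> mE mh Eh.
have mexp : measurable_fun setT (fun w => (expR (h w))%:E).
  by apply/measurable_EFinP; exact: measurableT_comp.
have <- : (\int[P]_w (\1_E w)%:E = P E)%E by rewrite integral_indic// setIT.
rewrite -ge0_integralZl//.
apply: ge0_le_integral => //.
- exact/measurable_EFinP/measurable_indic.
- exact: measurable_funeM.
- move=> w _; rewrite -EFinM lee_fin indicE -expRD.
  case: (boolP (w \in E)) => [/set_mem/Eh ahw|_]; last exact: expR_ge0.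
  by rewrite -expR0 ler_expR; lra.
Qed.

(** * Passing between risk deviations and distances of CDFs *)

Section T1_risk.
Context {R : realType} (L kappa : R) (rho : CDF R -> R).
Hypotheses (L_gt0 : 0 < L) (kappa_gt0 : 0 < kappa).
Hypothesis rhoT1 : type_T1 L kappa rho.

Lemma T1_dist_le (F G : CDF R) (r : R) :
  (\int[lebesgue_measure]_t (`|F t - G t|)%:E <= r%:E)%E ->
  `|rho F - rho G| <= L * r `^ kappa.
Proof.
move=> FGr; have W1r := le_trans (W1_le_integral F G) FGr.
have W10 : (0 <= W1 F G)%E.
  by apply: le_ereal_inf_tmp => _ [nu _ <-]; apply: integral_ge0.
have r0 : (0 <= r%:E)%E := le_trans W10 W1r.
rewrite -lee_fin (le_trans (rhoT1 F G))// EFinM -poweR_EFin.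
apply: lee_pmul => //; first by rewrite lee_fin ltW.
  exact: poweR_ge0.
apply: gt0_ler_poweR => //; first exact: ltW.
  by rewrite in_itv /= W10 leey.
by rewrite in_itv /= r0 leey.
Qed.

Lemma lt_T1_modulus (e r : R) : 0 < e -> 0 <= r ->
  (e < L * r `^ kappa) = ((e / L) `^ kappa^-1 < r).
Proof.
move=> e0 r0.
have eL : 0 <= e / L by rewrite divr_ge0// ltW.
rewrite mulrC -ltr_pdivrMr//.
have rE : r = (r `^ kappa) `^ kappa^-1 by rewrite -powRrM mulfV ?powRr1 ?gt_eqF.
rewrite [in RHS]rE ltNge [RHS]ltNge; congr (~~ _).
apply/idP/idP => h.
  by apply: ge0_ler_powR; rewrite ?nnegrE ?powR_ge0 ?invr_ge0 ?(ltW kappa_gt0).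
have {h} := @ge0_ler_powR _ kappa (ltW kappa_gt0) _ _ (powR_ge0 _ _) (powR_ge0
    _ _) h.
by rewrite -!powRrM mulVf ?mulfV ?gt_eqF// mulr1 !powRr1 ?powR_ge0.
Qed.

End T1_risk.

(** With [b = u c / 2] the powers of [c] cancel and the factor is [1 + 2 u^2 / (1 - u)]. *)
Lemma mgf_factor_le {R : realType} (c u : R) : 0 < c -> 0 <= u -> u < 1 ->
  mgf_factor c (u * c / 2) <= expR (2 * u ^+ 2 / (1 - u)).
Proof.
move=> c0 u0 u1; rewrite /mgf_factor.
have c_neq0 : c != 0 by rewrite gt_eqF.
have u_neq1 : 1 - u != 0 by rewrite gt_eqF// subr_gt0.
have -> : c - 2 * (u * c / 2) = c * (1 - u) by field.
have -> : 2 * (2 * (u * c / 2)) ^+ 2 / (c * (c * (1 - u))) = 2 * u ^+ 2 / (1 -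
    u).
  by field; rewrite ?c_neq0 ?u_neq1.
exact: expR_ge1Dx.
Qed.

(** * Tail bounds for the law and its CDF *)

Section law_tails.
Context {R : realType} {d} {T : measurableType d} (P : probability T R)
  (X : {RV P >-> R}) (c : R).
Hypothesis tailR : forall e : R, 0 <= e ->
  (P [set w | (e < X w)%R] <= (expR (- (c * e)))%:E)%E.
Hypothesis tailL : forall e : R, 0 <= e ->
  (P [set w | (X w <= - e)%R] <= (expR (- (c * e)))%:E)%E.

Lemma law_cdfE (t : R) : (law_cdf X t)%:E = P [set w | X w <= t].
Proof.
have -> : [set w | X w <= t] = X @^-1` `]-oo, t].
  by apply/seteqP; split => w /=; rewrite in_itv.
by rewrite /law_cdf /= /law_cdf_fun fineK ?fin_num_measure.
Qed.

Lemma law_norm_tail (t : R) : 0 <= t ->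
  (distribution P X [set y | (t < `|y|)%R] <= (2 * expR (- (c * t)))%:E)%E.
Proof.
move=> t0; rewrite /distribution /pushforward.
have mgt : measurable [set w | t < X w].
  have : measurable_fun setT (fun w => t < X w) by exact: measurable_fun_ltr.
  by move=> /(_ measurableT [set true] I); rewrite setTI.
have mle : measurable [set w | X w <= - t].
  have : measurable_fun setT (fun w => X w <= - t) by exact: measurable_fun_ler.
  by move=> /(_ measurableT [set true] I); rewrite setTI.
have mnorm : measurable (X @^-1` [set y | t < `|y|]).
  have : measurable_fun setT (fun w => t < `|X w|).
    by apply: measurable_fun_ltr => //; exact: measurableT_comp.
  by move=> /(_ measurableT [set true] I); rewrite setTI.
apply: (@le_trans _ _ (P ([set w | t < X w] `|` [set w | X w <= - t]))).
  apply: le_measure; rewrite ?inE//; first exact: measurableU.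
  move=> w /=; rewrite lter_normr => /orP[tX|tX]; [by left|right].
  by rewrite /= lerNr ltW.
apply: (le_trans (measureU2 _ mgt mle)).
have -> : 2 * expR (- (c * t)) = expR (- (c * t)) + expR (- (c * t)) by ring.
by rewrite EFinD leeD ?tailR ?tailL.
Qed.

Lemma law_cdf_tailL (t : R) : t <= 0 -> law_cdf X t <= expR (- (c * `|t|)).
Proof.
move=> t0; rewrite -lee_fin law_cdfE ler0_norm//.
by rewrite -{1}(opprK t) tailL// oppr_ge0.
Qed.

Lemma law_cdf_tailR (t : R) : 0 <= t -> 1 - law_cdf X t <= expR (- (c * `|t|)).
Proof.
move=> t0; rewrite -lee_fin EFinB law_cdfE ger0_norm//.
apply: le_trans (tailR _ t0).
have mle : measurable [set w | X w <= t].
  have : measurable_fun setT (fun w => X w <= t) by exact: measurable_fun_ler.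
  by move=> /(_ measurableT [set true] I); rewrite setTI.
rewrite -probability_setC// (_ : ~` _ = [set w | t < X w])//.
by apply/seteqP; split => w /=; rewrite ltNge => /negP.
Qed.

Lemma law_cdf_step_dist (t : R) :
  `|(0 <= t)%R%:R - law_cdf X t| <= expR (- (c * `|t|)).
Proof.
have /andP[F0 F1] := cdf_range (law_cdf X) t.
have [t0|/ltW t0] := leP 0 t.
  by rewrite ger0_norm ?subr_ge0//; exact: law_cdf_tailR.
by rewrite sub0r normrN ger0_norm//; exact: law_cdf_tailL.
Qed.

(** [F (1 - F)] is at most each of its factors, and the tail on the side of [t] controls one of
    them. *)
Lemma law_cdf_variance_le (t : R) :
  law_cdf X t - law_cdf X t ^+ 2 <= expR (- (c * `|t|)).
Proof.
have /andP[F0 F1] := cdf_range (law_cdf X) t.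
have [/law_cdf_tailR|/ltW/law_cdf_tailL] := leP 0 t; nra.
Qed.

End law_tails.

Theorem theorem41 (R : realType)
    (d0 : measure_display) (T0 : measurableType d0) (P0 : probability T0 R)
    (X : {RV P0 >-> R})
    (c : R) (c_gt0 : 0 < c)
    (tailR : forall e : R, 0 <= e ->
      (P0 [set w | (e < X w)%R] <= (expR (- (c * e)))%:E)%E)
    (tailL : forall e : R, 0 <= e ->
      (P0 [set w | (X w <= - e)%R] <= (expR (- (c * e)))%:E)%E)
    (L kappa : R) (L_gt0 : 0 < L) (kappa_gt0 : 0 < kappa)
    (kappa_le1 : kappa <= 1)
    (rho : CDF R -> R) (rhoT1 : type_T1 L kappa rho)
    (n : nat) (n_gt0 : (0 < n)%N)
    (d : measure_display) (T : measurableType d) (P : probability T R)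
    (Xs : 'I_n -> {RV P >-> R})
    (Xs_indep : mutually_independent Xs)
    (Xs_law : forall i, same_law (Xs i) X)
    (eps : R) (eps_gt0 : 0 < eps)
    (eps_large : 384 / (c * Num.sqrt n%:R) < (eps / L) `^ kappa^-1) :
  (P [set w | (eps < `|rho (empirical_cdf n_gt0 (fun i => Xs i w))
                      - rho (law_cdf X)|)%R]
   <= (let D := (eps / L) `^ kappa^-1 - 384 / (c * Num.sqrt n%:R) in
       expR (- (n%:R / (32 / c ^+ 2 + 4 / c * D) * D ^+ 2)))%R%:E)%E.
Proof.
set F := law_cdf X; set q := (eps / L) `^ kappa^-1.
set D := q - _; cbv zeta.
have D0 : 0 < D by rewrite subr_gt0.
have nR : 0 < n%:R :> R by rewrite ltr0n.
have sn : 0 < Num.sqrt n%:R :> R by rewrite sqrtr_gt0.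
set E := [set w | _].
have F_step := law_cdf_step_dist P0 X c tailR tailL.
have Xs_cdf i t : P [set w | Xs i w <= t] = (F t)%:E.
  rewrite law_cdfE; have := Xs_law i `]-oo, t]%classic (measurable_itv _).
  rewrite /distribution /pushforward.
  have pre (Y : T -> R) : Y @^-1` `]-oo, t] = [set w | Y w <= t].
    by apply/seteqP; split => w /=; rewrite in_itv.
  have pre0 (Y : T0 -> R) : Y @^-1` `]-oo, t] = [set w | Y w <= t].
    by apply/seteqP; split => w /=; rewrite in_itv.
  by rewrite pre pre0.
pose f := @cdf_dist R n F.
have f0 x : 0 <= f x by exact: cdf_dist_ge0.
have fE x : (f x)%:E = (\int[lebesgue_measure]_t (`|empirical_cdf_fun x t - F
    t|)%:E)%E.
  exact: (cdf_distE F c n_gt0 c_gt0 F_step).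
have f_lip x y : `|f x - f y| <= n%:R^-1 * l1dist x y.
  exact: (cdf_dist_lipschitz F c n_gt0 c_gt0 F_step).
have E_f w : E w -> q < f (Xs ^~ w).
  move=> /= Ew; rewrite -(lt_T1_modulus L kappa L_gt0 kappa_gt0 eps)//.
  apply: (lt_le_trans Ew); apply: (T1_dist_le L kappa rho L_gt0 kappa_gt0
      rhoT1).
  by rewrite fE.
(* [rho] is not assumed measurable, but (T1) makes the risk a continuous function of the sample for
   the l1 distance, so [E] is the preimage of an open set. *)
have mE : measurable E.
  apply: (@measurable_l1open_preimage _ T R n (fun i w => Xs i w)
    [set x | eps < `|rho (empirical_cdf n_gt0 x) - rho F|]) => // x /= xe.
  pose gap := `|rho (empirical_cdf n_gt0 x) - rho F| - eps.
  have gap0 : 0 < gap by rewrite subr_gt0.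
  (* The radius at which [L (l1dist / n)^kappa] reaches [gap]. *)
  exists (n%:R * (gap / L) `^ kappa^-1).
    by rewrite mulr_gt0// powR_gt0// divr_gt0.
  move=> y xy.
  have xy_le : (\int[lebesgue_measure]_t
      (`|empirical_cdf n_gt0 x t - empirical_cdf n_gt0 y t|)%:E
      <= (n%:R^-1 * l1dist x y)%:E)%E.
    exact: integral_empirical_cdf_fun_dist_le.
  have xy0 : 0 <= n%:R^-1 * l1dist x y by rewrite mulr_ge0 ?l1dist_ge0
      ?invr_ge0.
  have rho_xy : `|rho (empirical_cdf n_gt0 x) - rho (empirical_cdf n_gt0 y)| <
      gap.
    apply: (le_lt_trans (T1_dist_le L kappa rho L_gt0 kappa_gt0 rhoT1 _ _ _
        xy_le)).
    have gapL : gap = L * ((gap / L) `^ kappa^-1) `^ kappa.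
      rewrite -powRrM mulVf ?gt_eqF// powRr1 ?divr_ge0 ?ltW//.
      by rewrite mulrCA mulfV ?gt_eqF// mulr1.
    rewrite [ltRHS]gapL ltr_pM2l//.
    apply: gt0_ltr_powR => //; first by rewrite nnegrE powR_ge0.
    by rewrite mulrC ltr_pdivrMr// mulrC.
  have := ler_distD (rho (empirical_cdf n_gt0 y)) (rho (empirical_cdf n_gt0 x))
      (rho F).
  move: rho_xy; rewrite /gap; lra.
set t := c * D; have t0 : 0 < t by rewrite mulr_gt0.
(* this [u] turns the Chernoff exponent at [D] into exactly the claimed one *)
pose u := t / (8 + t).
have u0 : 0 < u by rewrite divr_gt0// addr_gt0.
have u1 : u < 1 by rewrite ltr_pdivrMr ?addr_gt0//; lra.
pose lambda := u * c / 2 * n%:R.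
have b0 : 0 < u * c / 2 by rewrite divr_gt0// mulr_gt0.
have lambda0 : 0 < lambda by rewrite mulr_gt0.
have bc : 2 * (u * c / 2) < c.
  have -> : 2 * (u * c / 2) = u * c by field.
  by rewrite gtr_pMl.
pose g x := lambda * f x.
have g_lip : lipschitz_l1 (u * c / 2) g.
  move=> x y; rewrite /g -mulrBr normrM gtr0_norm// (le_trans (ler_wpM2l _
      (f_lip x y)))//.
    exact: ltW.
  by rewrite mulrA /lambda mulfK ?gt_eqF.
have g0 x : 0 <= g x by rewrite mulr_ge0// ltW.
pose m := lambda * (4 / (c * Num.sqrt n%:R)).
have g_mean : (\int[P]_w (g (Xs ^~ w))%:E <= m%:E)%E.
  under eq_integral do rewrite /g EFinM.
  rewrite ge0_integralZl//; first last.
  - by rewrite lee_fin ltW.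
  - by move=> w _; rewrite lee_fin.
  - apply/measurable_EFinP.
    exact: (measurable_l1lipschitz (fun i w => Xs i w) f _ _ f_lip).
  rewrite /m [leRHS]EFinM; apply: lee_pmul => //; first by rewrite lee_fin ltW.
    by apply: integral_ge0 => w _; rewrite lee_fin.
  under eq_integral do rewrite fE.
  apply: mean_cdf_dist_le => // s; exact: (law_cdf_variance_le P0 X c tailR
      tailL).
have mgf : (\int[P]_w (expR (g (Xs ^~ w)))%:E
    <= (mgf_factor c (u * c / 2) ^+ size (enum 'I_n) * expR m)%:E)%E.
  apply: (integral_expR_le P Xs (distribution P0 X)) => //.
  - exact: (law_norm_tail P0 X c tailR tailL).
  - by move=> x y xy; congr (g _); apply/funext => i; apply: xy; rewrite
      mem_enum.
have mg : measurable_fun setT (fun w => g (Xs ^~ w)).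
  exact: (measurable_l1lipschitz (fun i w => Xs i w) g _ _ g_lip).
have E_g w : E w -> lambda * q <= g (Xs ^~ w).
  by move=> /E_f/ltW qf; rewrite ler_pM2l.
apply: (le_trans (exponential_markov P _ E _ mE mg E_g)).
apply: (le_trans (lee_pmul _ _ (lexx _) mgf)); rewrite ?lee_fin ?expR_ge0//.
  by apply: integral_ge0 => w _; rewrite lee_fin expR_ge0.
rewrite size_enum_ord mulrCA.
apply: (@le_trans _ _ (expR (2 * u ^+ 2 / (1 - u)) ^+ n * (expR (- (lambda *
    q)) * expR m))).
  apply: ler_wpM2r; first by rewrite mulr_ge0 ?expR_ge0.
  apply: lerXn2r; rewrite ?nnegrE ?expR_ge0//; first exact: mgf_factor_ge0.
  by apply: mgf_factor_le => //; exact: ltW.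
rewrite -expRM_natl -!expRD ler_expR.
have expo : - (n%:R / (32 / c ^+ 2 + 4 / c * D) * D ^+ 2)
    = n%:R * (2 * u ^+ 2 / (1 - u)) - lambda * D.
  have t8 : 8 + t != 0 by rewrite gt_eqF// addr_gt0.
  have -> : 1 - u = 8 / (8 + t) by rewrite /u; field.
  have c_neq0 : c != 0 by rewrite gt_eqF.
  have -> : 32 / c ^+ 2 + 4 / c * D = 4 * (8 + t) / c ^+ 2 by rewrite /t; field.
  have -> : D = t / c by rewrite /t; field.
  by rewrite /lambda /u; field; rewrite ?c_neq0 ?t8.
(* What remains is that the mean term, [4] times [lambda / (c sqrt n)], is at most the allowance of
   [384] times the same quantity. *)
rewrite expo lerD2l /m.
have z0 : 0 < lambda * (c * Num.sqrt n%:R)^-1 by rewrite mulr_gt0// invr_gt0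
    mulr_gt0.
have -> : q = D + 384 / (c * Num.sqrt n%:R) by rewrite /D subrK.
by move: z0; lra.
Qed.
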